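(* The assignment $\mathcal{E}_i\mapsto F_i+q^{\epsilon-1}E_{i-1}K_{-\alpha_{i-1}}$ ($i\in\mathbb{Z}$) extends to an injective $\mathbb{Q}(q)$-algebra homomorphism $j\colon \mathrm{El}_\epsilon\to U$. Its image $C=j(\mathrm{El}_\epsilon)$ is a right coideal subalgebra of $U$, i.e. $\Delta(C)\subseteq C\otimes U$; more precisely $\Delta(j(\mathcal{E}_i))=1\otimes j(\mathcal{E}_i)+j(\mathcal{E}_i)\otimes K_{\beta_i}$ for all $i\in\mathbb{Z}$.
   Context: $\mathbb{Q}(q)$ is the field of rational functions in $q$ over $\mathbb{Q}$; $[2]=q+q^{-1}$. Fix $\epsilon\in\{1,-1\}$. For $i,j\in\mathbb{Z}$ put $b_{ij}=-2$ if $j\in\{i,i+1\}$ and $b_{ij}=4\,\mathrm{sgn}(j-i)(-1)^{j-i}$ otherwise. The $q$-electrical algebra $\mathrm{El}_\epsilon$ is the $\mathbb{Q}(q)$-algebra generated by $\mathcal{E}_i$, $i\in\mathbb{Z}$, subject to: $\mathcal{E}_i\mathcal{E}_j=q^{b_{ij}}\mathcal{E}_j\mathcal{E}_i$ if $|i-j|>1$; $q^3\mathcal{E}_i^2\mathcal{E}_{i+1}-[2]\mathcal{E}_i\mathcal{E}_{i+1}\mathcal{E}_i+q^{-3}\mathcal{E}_{i+1}\mathcal{E}_i^2=-q^{\epsilon}[2]\mathcal{E}_i$; $q^{-3}\mathcal{E}_i^2\mathcal{E}_{i-1}-[2]\mathcal{E}_i\mathcal{E}_{i-1}\mathcal{E}_i+q^{3}\mathcal{E}_{i-1}\mathcal{E}_i^2=-q^{\epsilon}[2]\mathcal{E}_i$.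 Let $\mathfrak{h}_{\mathbb{Z}}$ be the free $\mathbb{Z}$-module with basis $e_i$, $i\in\mathbb{Z}$, $X=\mathrm{Hom}_{\mathbb{Z}}(\mathfrak{h}_{\mathbb{Z}},\mathbb{Z})$, $\langle\cdot,\cdot\rangle$ the evaluation, $\alpha_i^\vee=e_{i+1}-e_i$, $\varepsilon_i\in X$ with $\langle\varepsilon_i,e_j\rangle=\delta_{ij}$, $\alpha_i=\varepsilon_{i+1}-\varepsilon_i$. Define $\beta_i\in X$ by $\langle\beta_i,e_j\rangle=(-1)^i2$ if $j=i$, $=(-1)^i4$ if $j\ne i$ and $(-1)^jj>(-1)^ji$, and $=0$ otherwise; put $\gamma_i=-\beta_{i+1}$, and $\beta_{ij}=\langle\gamma_i-\alpha_i,\alpha_j^\vee\rangle$ (explicitly $0$ if $i=j$, $3(j-i)$ if $|i-j|=1$, $-4\,\mathrm{sgn}(j-i)(-1)^{j-i}$ otherwise). $U$ is the $\mathbb{Q}(q)$-algebra generated by $E_i,F_i$ ($i\in\mathbb{Z}$), $K_\lambda$ ($\lambda\in X$) subject to: $K_\lambda K_\mu=K_{\lambda+\mu}$, $K_0=1$; $K_\lambda F_i=q^{-\langle\lambda,\alpha_i^\vee\rangle}F_iK_\lambda$, $K_\lambda E_i=q^{\langle\lambda,\alpha_i^\vee\rangle}E_iK_\lambda$; $E_iF_j-q^{\beta_{ij}}F_jE_i=\delta_{ij}\frac{K_{\alpha_i}-K_{-\alpha_i}}{q-q^{-1}}$; $F_iF_j=q^{b_{ij}}F_jF_i$, $E_iE_j=q^{b_{ij}}E_jE_i$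 for $|i-j|>1$; $q^3F_i^2F_{i+1}-[2]F_iF_{i+1}F_i+q^{-3}F_{i+1}F_i^2=0$, $q^{-3}F_i^2F_{i-1}-[2]F_iF_{i-1}F_i+q^3F_{i-1}F_i^2=0$ and the same with $F$ replaced by $E$. $U$ is a Hopf algebra with comultiplication the algebra homomorphism $\Delta\colon U\to U\otimes U$ determined by $\Delta(F_i)=F_i\otimes K_{\beta_i}+1\otimes F_i$, $\Delta(E_i)=K_{\alpha_i}\otimes E_i+E_i\otimes K_{\alpha_i-\gamma_i}$, $\Delta(K_\lambda)=K_\lambda\otimes K_\lambda$. *)

(* Defs.v *)
From HB Require Import structures.
From mathcomp Require Import all_boot all_order all_algebra fraction.
Set Implicit Arguments. Unset Strict Implicit. Unset Printing Implicit Defensive.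
Import Order.TTheory GRing.Theory Num.Theory.
Local Open Scope ring_scope.

Definition Kf : fieldType := {fraction {poly rat}}.
Definition q : Kf := @FracField.tofrac {poly rat} (polyX rat).
Definition q2 : Kf := q + q^-1.

(** Terms of the free unital associative Kf-algebra on generators G *)
Inductive term (G : Type) : Type :=
| tC : Kf -> term G
| tG : G -> term G
| tAdd : term G -> term G -> term G
| tMul : term G -> term G -> term G.
Arguments tC {G} c.
Arguments tG {G} g.

Definition t0 {G} : term G := tC 0.
Definition t1 {G} : term G := tC 1.
Definition tScale {G} (c : Kf) (t : term G) : term G := tMul (tC c) t.
Definition tSub {G} (s t : term G) : term G := tAdd s (tScale (-1) t).
Definition tsum {G} (s : seq (term G)) : term G := foldr (@tAdd G) t0 s.

Fixpoint tmap {G H : Type} (f : G -> term H) (t : term G) : term H :=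
  match t with
  | tC c => tC c
  | tG g => f g
  | tAdd a b => tAdd (tmap f a) (tmap f b)
  | tMul a b => tMul (tmap f a) (tmap f b)
  end.

(** Equality in the presented algebra  Kf<G> / (two-sided ideal generated by
    the relations s = t with R s t): the congruence generated by the axioms of
    associative unital Kf-algebras and by R. *)
Section Presented.
Variable G : Type.
Variable R : term G -> term G -> Prop.
Inductive peqv : term G -> term G -> Prop :=
| pe_rel s t : R s t -> peqv s t
| pe_refl t : peqv t t
| pe_sym s t : peqv s t -> peqv t s
| pe_trans s t u : peqv s t -> peqv t u -> peqv s u
| pe_add a a' b b' : peqv a a' -> peqv b b' -> peqv (tAdd a b) (tAdd a' b')
| pe_mul a a' b b' : peqv a a' -> peqv b b' -> peqv (tMul a b) (tMul a' b')
| pe_addA a b c : peqv (tAdd a (tAdd b c)) (tAdd (tAdd a b) c)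
| pe_addC a b : peqv (tAdd a b) (tAdd b a)
| pe_add0 a : peqv (tAdd t0 a) a
| pe_addN a : peqv (tAdd a (tScale (-1) a)) t0
| pe_mulA a b c : peqv (tMul a (tMul b c)) (tMul (tMul a b) c)
| pe_mul1l a : peqv (tMul t1 a) a
| pe_mul1r a : peqv (tMul a t1) a
| pe_mulDl a b c : peqv (tMul (tAdd a b) c) (tAdd (tMul a c) (tMul b c))
| pe_mulDr a b c : peqv (tMul a (tAdd b c)) (tAdd (tMul a b) (tMul a c))
| pe_CD x y : peqv (tC (x + y)) (tAdd (tC x) (tC y))
| pe_CM x y : peqv (tC (x * y)) (tMul (tC x) (tC y))
| pe_Ccomm x a : peqv (tMul (tC x) a) (tMul a (tC x)).
End Presented.

Definition negpow (n : int) : int := if odd `|n|%N then -1 else 1.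

(** Weight lattice X = Hom(h_Z, Z) = functions Z -> Z (value at e_j) *)
Definition weight := int -> int.
Definition wadd (l m : weight) : weight := fun j => l j + m j.
Definition wopp (l : weight) : weight := fun j => - l j.
Definition w0 : weight := fun _ => 0.
Definition corootpair (l : weight) (i : int) : int := l (i + 1) - l i.
Definition epsw (i : int) : weight := fun j => if j == i then 1 else 0.
Definition alpha (i : int) : weight := fun j => epsw (i + 1) j - epsw i j.
Definition beta (i : int) : weight := fun j =>
  if j == i then negpow i * 2
  else if negpow j * i < negpow j * j then negpow i * 4 else 0.
Definition gamma (i : int) : weight := wopp (beta (i + 1)).
Definition betaij (i j : int) : int :=
  corootpair (wadd (gamma i) (wopp (alpha i))) j.
Definition bij (i j : int) : int :=
  if (j == i) || (j == i + 1) then -2 else 4 * sgz (j - i) * negpow (j - i).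

Definition serre {G} (c1 c3 : Kf) (a b : term G) : term G :=
  tAdd (tAdd (tScale c1 (tMul a (tMul a b))) (tScale (- q2) (tMul a (tMul b a))))
        (tScale c3 (tMul b (tMul a a))).

Inductive relEl (eps : int) : term int -> term int -> Prop :=
| rEl_comm i j : 1 < `|i - j| ->
    relEl eps (tMul (tG i) (tG j)) (tScale (q ^ bij i j) (tMul (tG j) (tG i)))
| rEl_S1 i : relEl eps
    (serre (q ^ 3) (q ^ (-3)) (tG i) (tG (i + 1)))
    (tScale (- (q ^ eps * q2)) (tG i))
| rEl_S2 i : relEl eps
    (serre (q ^ (-3)) (q ^ 3) (tG i) (tG (i - 1)))
    (tScale (- (q ^ eps * q2)) (tG i)).
Definition El_eqv (eps : int) := peqv (relEl eps).

Inductive Ugen : Type := UE of int | UF of int | UK of weight.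
Notation E i := (tG (UE i)).
Notation F i := (tG (UF i)).
Notation Kw l := (tG (UK l)).

Inductive relU : term Ugen -> term Ugen -> Prop :=
| rU_KK l m : relU (tMul (Kw l) (Kw m)) (Kw (wadd l m))
| rU_K0 : relU (Kw w0) t1
| rU_Kext l m : (forall j, l j = m j) -> relU (Kw l) (Kw m)
| rU_KF l i : relU (tMul (Kw l) (F i))
                   (tScale (q ^ (- corootpair l i)) (tMul (F i) (Kw l)))
| rU_KE l i : relU (tMul (Kw l) (E i))
                   (tScale (q ^ (corootpair l i)) (tMul (E i) (Kw l)))
| rU_EF i j : relU (tSub (tMul (E i) (F j)) (tScale (q ^ betaij i j) (tMul (F j) (E i))))
                   (if i == j then
                      tScale ((q - q^-1)^-1) (tSub (Kw (alpha i)) (Kw (wopp (alpha i))))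
                    else t0)
| rU_FF i j : 1 < `|i - j| ->
    relU (tMul (F i) (F j)) (tScale (q ^ bij i j) (tMul (F j) (F i)))
| rU_EE i j : 1 < `|i - j| ->
    relU (tMul (E i) (E j)) (tScale (q ^ bij i j) (tMul (E j) (E i)))
| rU_FS1 i : relU (serre (q ^ 3) (q ^ (-3)) (F i) (F (i + 1))) t0
| rU_FS2 i : relU (serre (q ^ (-3)) (q ^ 3) (F i) (F (i - 1))) t0
| rU_ES1 i : relU (serre (q ^ 3) (q ^ (-3)) (E i) (E (i + 1))) t0
| rU_ES2 i : relU (serre (q ^ (-3)) (q ^ 3) (E i) (E (i - 1))) t0.
Definition U_eqv := peqv relU.

(** U (x) U, presented as the algebra generated by two commuting copies of U *)
Definition UUgen := (Ugen + Ugen)%type.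
Definition embL : term Ugen -> term UUgen := tmap (fun g => tG (inl g)).
Definition embR : term Ugen -> term UUgen := tmap (fun g => tG (inr g)).
Inductive relUU : term UUgen -> term UUgen -> Prop :=
| rUU_L s t : relU s t -> relUU (embL s) (embL t)
| rUU_R s t : relU s t -> relUU (embR s) (embR t)
| rUU_comm g h : relUU (tMul (tG (inl g)) (tG (inr h))) (tMul (tG (inr h)) (tG (inl g))).
Definition UU_eqv := peqv relUU.
Definition tens (s t : term Ugen) : term UUgen := tMul (embL s) (embR t).

Definition Delta_gen (g : Ugen) : term UUgen :=
  match g with
  | UF i => tAdd (tens (F i) (Kw (beta i))) (tens t1 (F i))
  | UE i => tAdd (tens (Kw (alpha i)) (E i))
                 (tens (E i) (Kw (wadd (alpha i) (wopp (gamma i)))))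
  | UK l => tens (Kw l) (Kw l)
  end.
Definition Delta : term Ugen -> term UUgen := tmap Delta_gen.

Definition j_gen (eps : int) (i : int) : term Ugen :=
  tAdd (F i) (tScale (q ^ (eps - 1)) (tMul (E (i - 1)) (Kw (wopp (alpha (i - 1)))))).
Definition jmap (eps : int) : term int -> term Ugen := tmap (j_gen eps).

(* Main.v *)
(** The algebra [U] acts on its negative part [N], presented by the [F_i] alone, as on the
    Verma module of highest weight 0: [F_i] acts by left multiplication, [K_l] by scaling, and
    [E_k] by a skew derivation, obtained as the off-diagonal entry of a representation of [N]
    by triangular 2x2 matrices.  The same commutation of [E_k] with the Serre elements in the
    [F_i] shows that [E_k] is well defined and, with the roles of [E] and [F] exchanged, that
    the operators [E_k] satisfy the relations of [U].

    Pulling this module back along [j] and applying it to the highest weight vector gives a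
    filtered linear map [phi : El -> N].  Since [E_k] does not raise degrees, the leading term
    of [phi] replaces each generator of [El] by the corresponding [F_i].  Conversely, as the
    relations of [El] are those of [N] up to lower terms, [N] acts on the associated graded
    space of [El], which recovers the leading term of an element of [El] from that of its image
    under [phi].  Hence [phi], and therefore [j], is injective. *)
Require Import Defs.
From HB Require Import structures.
From mathcomp Require Import all_boot all_order all_algebra fraction.
From mathcomp Require Import zify ring generic_quotient boolp functions.
Set Implicit Arguments. Unset Strict Implicit. Unset Printing Implicit Defensive.
Import Order.TTheory GRing.Theory Num.Theory.
Local Open Scope ring_scope.

(** * Presented algebras acting on vector spaces *)

Section Action.
Variables (G : Type) (V : lmodType Kf) (rho : G -> {linear V -> V}).

Fixpoint act (t : term G) : V -> V :=
  match t with
  | tC c => fun v => c *: v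
  | tG g => fun v => rho g v
  | tAdd a b => fun v => act a v + act b v
  | tMul a b => fun v => act a (act b v)
  end.

Lemma act_is_linear t : linear (act t).
Proof.
elim: t => [c|g|a IHa b IHb|a IHa b IHb] k u v /=.
- by rewrite scalerDr !scalerA mulrC.
- exact: linearP.
- by rewrite IHa IHb scalerDr addrACA.
- by rewrite IHb IHa.
Qed.

HB.instance Definition _ t :=
  GRing.isLinear.Build Kf V V _ (act t) (act_is_linear t).

Section Sound.
Variables (R : term G -> term G -> Prop) (good null : V -> Prop).
Hypothesis null0 : null 0.
Hypothesis nullD : forall u v, null u -> null v -> null (u + v).
Hypothesis nullZ : forall c v, null v -> null (c *: v).
Hypothesis null_rho : forall g v, null v -> null (rho g v).
Hypothesis goodD : forall u v, good u -> good v -> good (u + v).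
Hypothesis goodZ : forall c v, good v -> good (c *: v).
Hypothesis good_rho : forall g v, good v -> good (rho g v).
Hypothesis relR : forall s t v, R s t -> good v -> null (act s v - act t v).

Lemma act_null t v : null v -> null (act t v).
Proof.
elim: t v => [c|g|a IHa b IHb|a IHa b IHb] v nv /=; auto.
Qed.

Lemma act_good t v : good v -> good (act t v).
Proof.
elim: t v => [c|g|a IHa b IHb|a IHa b IHb] v nv /=; auto.
Qed.

(* Two terms equal in the presented algebra act equally on the subquotient
   of [V] cut out by the subspaces [good] and [null]. *)
Lemma act_sound_mod s t v :
  peqv R s t -> good v -> null (act s v - act t v).
Proof.
move=> st; elim: st v => {s t}.
- by move=> s t Rst v gv; apply: relR.
- by move=> t v _; rewrite subrr.
- by move=> s t _ IH v gv; rewrite -opprB -scaleN1r; apply/nullZ/IH.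
- move=> s t u _ IH1 _ IH2 v gv.
  by rewrite -(subrK (act t v) (act s v)) -addrA; apply: nullD; auto.
- by move=> a a' b b' _ IH1 _ IH2 v gv /=; rewrite opprD addrACA; apply: nullD; auto.
- move=> a a' b b' _ IH1 _ IH2 v gv /=.
  rewrite -(subrK (act a (act b' v)) (act a (act b v))) -addrA -raddfB.
  by apply: nullD; [apply/act_null/IH2 | apply/IH1/act_good].
- by move=> a b c v _ /=; rewrite addrA subrr.
- by move=> a b v _ /=; rewrite (addrC (act b v)) subrr.
- by move=> a v _ /=; rewrite scale0r add0r subrr.
- by move=> a v _ /=; rewrite scale0r subr0 scaleN1r subrr.
- by move=> a b c v _ /=; rewrite subrr.
- by move=> a v _ /=; rewrite scale1r subrr.
- by move=> a v _ /=; rewrite scale1r subrr.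
- by move=> a b c v _ /=; rewrite subrr.
- by move=> a b c v _ /=; rewrite raddfD subrr.
- by move=> x y v _ /=; rewrite scalerDl subrr.
- by move=> x y v _ /=; rewrite scalerA subrr.
- by move=> x a v _ /=; rewrite linearZ subrr.
Qed.
End Sound.

Lemma act_sound (R : term G -> term G -> Prop) :
  (forall s t v, R s t -> act s v = act t v) ->
  forall s t v, peqv R s t -> act s v = act t v.
Proof.
move=> relR s t v st; apply/subr0_eq.
apply: (@act_sound_mod R (fun _ => True) (fun v => v = 0)) (st) _ => //.
- by move=> u w -> ->; rewrite addr0.
- by move=> c u ->; rewrite scaler0.
- by move=> g u ->; rewrite raddf0.
- by move=> s' t' u /relR -> _; rewrite subrr.
Qed.

End Action.

Lemma act_tmap (G H : Type) (V : lmodType Kf) (rho : H -> {linear V -> V})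
    (f : G -> term H) t v :
  act rho (tmap f t) v = act (fun g => act rho (f g) : {linear V -> V}) t v.
Proof.
by elim: t v => [c|g|a IHa b IHb|a IHa b IHb] v //=; rewrite ?IHb ?IHa.
Qed.

(** * The presented algebra as a cyclic left module with its universal property *)

Section PresentedAlgebra.
Local Open Scope quotient_scope.
Variables (G : Type) (R : term G -> term G -> Prop).

HB.instance Definition _ := gen_eqMixin (term G).
HB.instance Definition _ := gen_choiceMixin (term G).

(** Quotient types are formed by Boolean relations, and equality in a presented algebra is in
    general undecidable; hence the classical reflection. *)
Definition peqvb : rel (term G) := fun s t => `[< peqv R s t >].

Lemma peqvb_refl : reflexive peqvb.
Proof. by move=> t; apply/asboolP/pe_refl. Qed.
Lemma peqvb_sym : symmetric peqvb.
Proof. by move=> s t; apply/asboolP/asboolP; apply: pe_sym. Qed.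
Lemma peqvb_trans : transitive peqvb.
Proof. by move=> t s u /asboolP st /asboolP tu; apply/asboolP/(pe_trans st tu). Qed.

Definition peqv_equiv := EquivRel peqvb peqvb_refl peqvb_sym peqvb_trans.
Definition palg := {eq_quot peqv_equiv}.
HB.instance Definition _ := Choice.on palg.

Definition pcls (t : term G) : palg := \pi_({eq_quot peqv_equiv}) t.
Definition prep (x : palg) : term G := repr (x : {eq_quot peqv_equiv}).

Lemma prepK x : pcls (prep x) = x.
Proof. exact: reprK. Qed.

Lemma pcls_eq s t : pcls s = pcls t <-> peqv R s t.
Proof.
split=> [/eqmodP/asboolP //|st]; by apply/eqmodP/asboolP.
Qed.

Lemma prep_eqv t : peqv R (prep (pcls t)) t.
Proof. by apply/pcls_eq; rewrite prepK. Qed.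

Definition padd x y := pcls (tAdd (prep x) (prep y)).
Definition popp x := pcls (tScale (-1) (prep x)).
Definition pscale c x := pcls (tScale c (prep x)).
(** The left factor stays a term: the presented algebra serves as a left module over the free
    algebra, so no product of classes is set up. *)
Definition pmul t x := pcls (tMul t (prep x)).

Lemma paddE s t : padd (pcls s) (pcls t) = pcls (tAdd s t).
Proof. by apply/pcls_eq/pe_add; apply: prep_eqv. Qed.
Lemma pmulE s t : pmul s (pcls t) = pcls (tMul s t).
Proof. by apply/pcls_eq/pe_mul; [apply: pe_refl|apply: prep_eqv]. Qed.
Lemma pscaleE c t : pscale c (pcls t) = pcls (tScale c t).
Proof. exact: pmulE. Qed.

Lemma pind (P : palg -> Prop) : (forall t, P (pcls t)) -> forall x, P x.
Proof. by move=> Pt x; rewrite -(prepK x). Qed.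

Lemma paddA : associative padd.
Proof.
elim/pind=> a; elim/pind=> b; elim/pind=> c; rewrite !paddE.
exact/pcls_eq/pe_addA.
Qed.
Lemma paddC : commutative padd.
Proof. by elim/pind=> a; elim/pind=> b; rewrite !paddE; apply/pcls_eq/pe_addC. Qed.
Lemma padd0 : left_id (pcls t0) padd.
Proof. by elim/pind=> a; rewrite !paddE; apply/pcls_eq/pe_add0. Qed.
Lemma paddN : left_inverse (pcls t0) popp padd.
Proof.
elim/pind=> a; rewrite paddC /popp -/(pscale _ _) pscaleE paddE.
exact/pcls_eq/pe_addN.
Qed.

HB.instance Definition _ := GRing.isZmodule.Build palg paddA paddC padd0 paddN.

Lemma pscaleA a b x : pscale a (pscale b x) = pscale (a * b) x.
Proof.
elim/pind: x => x; rewrite !pscaleE; apply/pcls_eq.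
apply: pe_trans; first exact: pe_mulA.
by apply: pe_mul; [apply/pe_sym/pe_CM | apply: pe_refl].
Qed.
Lemma pscale1 : left_id 1 pscale.
Proof. by elim/pind=> a; rewrite pscaleE; apply/pcls_eq/pe_mul1l. Qed.
Lemma pscaleDr : right_distributive pscale padd.
Proof.
move=> c; elim/pind=> a; elim/pind=> b.
by rewrite !(pscaleE, paddE); apply/pcls_eq; apply: pe_mulDr.
Qed.
Lemma pscaleDl v : {morph pscale^~ v : a b / a + b >-> padd a b}.
Proof.
elim/pind: v => v a b; rewrite !(pscaleE, paddE); apply/pcls_eq.
apply: pe_trans; last exact: pe_mulDl.
by apply: pe_mul; [apply: pe_CD|apply: pe_refl].
Qed.

HB.instance Definition _ :=
  GRing.Zmodule_isLmodule.Build Kf palg pscaleA pscale1 pscaleDr pscaleDl.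

Lemma pclsD s t : pcls (tAdd s t) = pcls s + pcls t.
Proof. by rewrite -paddE. Qed.
Lemma pclsZ c t : pcls (tScale c t) = c *: pcls t.
Proof. by rewrite -pscaleE. Qed.

Lemma pmul_is_linear t : linear (pmul t).
Proof.
move=> c; elim/pind=> a; elim/pind=> b.
rewrite -pclsZ -pclsD !pmulE -pclsZ -pclsD; apply/pcls_eq.
apply: pe_trans; first exact: pe_mulDr.
apply: pe_add; last exact: pe_refl.
apply: pe_trans; first exact: pe_mulA.
apply: pe_trans; last by apply/pe_sym/pe_mulA.
by apply: pe_mul; [apply/pe_sym/pe_Ccomm | apply: pe_refl].
Qed.
HB.instance Definition _ t :=
  GRing.isLinear.Build Kf palg palg _ (pmul t) (pmul_is_linear t).

(** Locked, so that simplification does not expose the chosen representatives inside [pmul]. *)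
Definition pgen (g : G) : {linear palg -> palg} :=
  locked (pmul (tG g) : {linear palg -> palg}).
Definition pone : palg := pcls t1.

Lemma act_pgen s t : act pgen s (pcls t) = pcls (tMul s t).
Proof.
elim: s t => [c|g|a IHa b IHb|a IHa b IHb] t /=.
- by rewrite -pclsZ.
- by rewrite /pgen -lock /= pmulE.
- by rewrite IHa IHb -pclsD; apply/pcls_eq/pe_sym/pe_mulDl.
- by rewrite IHb IHa; apply/pcls_eq/pe_mulA.
Qed.

(** Acting on the unit recovers the class of a term, so an identity in the presented algebra can be
    checked as an identity of operators. *)
Lemma act_pone s : act pgen s pone = pcls s.
Proof. by rewrite act_pgen; apply/pcls_eq/pe_mul1r. Qed.

Lemma act_pgen_sound s t x : peqv R s t -> act pgen s x = act pgen t x.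
Proof.
elim/pind: x => x st; rewrite !act_pgen; apply/pcls_eq/pe_mul => //.
exact: pe_refl.
Qed.

Lemma palg_ind (P : palg -> Prop) :
  P pone -> (forall x y, P x -> P y -> P (x + y)) ->
  (forall c x, P x -> P (c *: x)) -> (forall g x, P x -> P (pgen g x)) ->
  forall x, P x.
Proof.
move=> P1 PD PZ PG; elim/pind=> t; rewrite -act_pone.
(* The vector is generalized because in a product the left factor acts on an arbitrary vector. *)
have: P pone by []; move: pone.
elim: t => [c|g|a IHa b IHb|a IHa b IHb] v Pv.
- exact: PZ.
- exact: PG.
- by apply: PD; [apply: IHa | apply: IHb].
- exact/IHa/IHb.
Qed.

Section Lift.
Variables (W : lmodType Kf) (rho : G -> {linear W -> W}) (w : W).
Variable (relR : forall s t v, R s t -> act rho s v = act rho t v).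

(** The proof of the relations is an explicit argument, so that the linearity instance below, which
    depends on it, can be inferred from the term. *)
Definition plift_fun of (forall s t v, R s t -> act rho s v = act rho t v) :=
  fun x : palg => act rho (prep x) w.

Lemma plift_cls t : plift_fun relR (pcls t) = act rho t w.
Proof. exact/act_sound/prep_eqv. Qed.

Lemma plift_is_linear : linear (plift_fun relR).
Proof.
move=> c; elim/pind=> a; elim/pind=> b.
by rewrite -pclsZ -pclsD !plift_cls.
Qed.
HB.instance Definition _ :=
  GRing.isLinear.Build Kf palg W _ (plift_fun relR) plift_is_linear.
Definition plift : {linear palg -> W} := plift_fun relR.

Lemma plift1 : plift pone = w.
Proof. by rewrite /= plift_cls /= scale1r. Qed.
Lemma plift_gen g x : plift (pgen g x) = rho g (plift x).
Proof. by elim/pind: x => t; rewrite /pgen -lock /= pmulE !plift_cls. Qed.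
End Lift.

End PresentedAlgebra.
Arguments pgen {G R} g.
Arguments pone {G R}.

(** * Operator identities *)

Section LinearCombinations.
Variables (K : fieldType) (V : lmodType K).

Inductive lexp : Type :=
| LAtom of nat | LZero | LAdd of lexp & lexp | LOpp of lexp | LScale of K & lexp.

Fixpoint leval (env : seq V) (e : lexp) : V :=
  match e with
  | LAtom n => nth 0 env n
  | LZero => 0
  | LAdd a b => leval env a + leval env b
  | LOpp a => - leval env a
  | LScale c a => c *: leval env a
  end.

Fixpoint lcoef (n : nat) (e : lexp) : K :=
  match e with
  | LAtom m => if Nat.eqb m n then 1 else 0
  | LZero => 0
  | LAdd a b => lcoef n a + lcoef n b
  | LOpp a => - lcoef n a
  | LScale c a => c * lcoef n a
  end.

Fixpoint lcheck (e1 e2 : lexp) (n : nat) : Prop :=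
  match n with
  | 0 => True
  | S m => lcoef m e1 = lcoef m e2 /\ lcheck e1 e2 m
  end.

Lemma leval_coef env e :
  leval env e = \sum_(n < size env) lcoef n e *: nth 0 env n.
Proof.
elim: e => [m||a IHa b IHb|a IHa|c a IHa] /=; rewrite ?IHa ?IHb.
- have [lt_m|le_m] := ltnP m (size env).
    rewrite (bigD1 (Ordinal lt_m)) //= big1 ?addr0 => [|i ne_i].
      by rewrite PeanoNat.Nat.eqb_refl scale1r.
    case: (PeanoNat.Nat.eqb_spec m i) => [e|_]; last by rewrite scale0r.
    by move: ne_i; rewrite -val_eqE /= e eqxx.
  rewrite nth_default // big1 // => i _.
  case: (PeanoNat.Nat.eqb_spec m i) => [e|_]; last by rewrite scale0r.
  by move: (ltn_ord i); rewrite -e ltnNge le_m.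
- by rewrite big1 // => i _; rewrite scale0r.
- by rewrite -big_split; apply: eq_bigr => i _; rewrite scalerDl.
- by rewrite -sumrN; apply: eq_bigr => i _; rewrite scaleNr.
- by rewrite scaler_sumr; apply: eq_bigr => i _; rewrite scalerA.
Qed.

Lemma lexp_eq env e1 e2 : lcheck e1 e2 (size env) -> leval env e1 = leval env e2.
Proof.
move=> chk; rewrite !leval_coef; apply: eq_bigr => -[i lt_i] _ /=.
congr (_ *: _); move: chk lt_i; elim: (size env) => // n IH /= [eq_n chk].
by rewrite ltnS leq_eqVlt => /orP[/eqP->|/(IH chk)].
Qed.
End LinearCombinations.

Ltac lin_index x env :=
  lazymatch env with
  | x :: _ => constr:(0%N)
  | _ :: ?env' => let n := lin_index x env' in constr:(S n)
  end.

Ltac lin_atoms t env :=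
  lazymatch t with
  | (?a + ?b)%R => let env1 := lin_atoms a env in lin_atoms b env1
  | (- ?a)%R => lin_atoms a env
  | (_ *: ?a)%R => lin_atoms a env
  | (0)%R => env
  | _ => match env with
         | context [t :: _] => env
         | _ => constr:(t :: env)
         end
  end.

Ltac lin_reify K t env :=
  lazymatch t with
  | (?a + ?b)%R => let a' := lin_reify K a env in let b' := lin_reify K b env in
                   constr:(LAdd a' b')
  | (- ?a)%R => let a' := lin_reify K a env in constr:(LOpp a')
  | (?c *: ?a)%R => let a' := lin_reify K a env in constr:(LScale c a')
  | (0)%R => constr:(@LZero K)
  | _ => let n := lin_index t env in constr:(@LAtom K n)
  end.

(* Reduces an equation between linear combinations of atoms to one equation
   between coefficients per atom. *)
Ltac linear_combination K :=
  lazymatch goal with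
  | |- @eq ?V ?l ?r =>
    let env := lin_atoms l (@nil V) in
    let env := lin_atoms r env in
    let e1 := lin_reify K l env in
    let e2 := lin_reify K r env in
    refine (@lexp_eq _ _ env e1 e2 _);
    cbv [lcheck lcoef size Nat.eqb]; repeat split
  end.

(* [linearD] and friends in a syntactic form in which all the operators go
   through the same coercion, as atom recognition requires. *)
Section LinearRules.
Variables (K : fieldType) (V W : lmodType K) (f : {linear V -> W}).
Lemma lin_D u v : f (u + v) = f u + f v. Proof. exact: linearD. Qed.
Lemma lin_N u : f (- u) = - f u. Proof. exact: linearN. Qed.
Lemma lin_Z c u : f (c *: u) = c *: f u. Proof. exact: linearZ. Qed.
Definition lin_rules := (lin_D, lin_N, lin_Z).
End LinearRules.

(** * Moving an operator through Serre and commutation relations *)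

Section SerreOperators.
Variables (K : fieldType) (V V' : lmodType K).

(* The action of [serre c1 c3 a b], with [t] in place of [q2]. *)
Definition serre_op (W : lmodType K) (c1 t c3 : K) (f g : W -> W) (v : W) : W :=
  c1 *: f (f (g v)) + (- t) *: f (g (f v)) + c3 *: g (f (f v)).

Variables (e P M : {linear V -> V'}) (f g : {linear V -> V}) (f' g' : {linear V' -> V'}).
Variables (x h : K).
Hypothesis x0 : x != 0.

Let lin := (lin_rules e, lin_rules P, lin_rules M, lin_rules f', lin_rules g').

(** Here [e] behaves like [E_k], [f] like [F_k], and [P], [M] like [K] at plus and minus [alpha k].
    Moving [e] to the right creates terms in [P] and [M] that cancel. Taking [x] to be [q] or its
    inverse covers both Serre relations. *)
Lemma serre_op_first :
  (forall v, e (f v) = f' (e v) + h *: (P v - M v)) ->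
  (forall v, e (g v) = x ^+ 3 *: g' (e v)) ->
  (forall v, P (f v) = x ^- 2 *: f' (P v)) -> (forall v, P (g v) = x *: g' (P v)) ->
  (forall v, M (f v) = x ^+ 2 *: f' (M v)) -> (forall v, M (g v) = x^-1 *: g' (M v)) ->
  forall v, e (serre_op (x ^+ 3) (x + x^-1) (x ^- 3) f g v)
          = x ^+ 3 *: serre_op (x ^+ 3) (x + x^-1) (x ^- 3) f' g' (e v).
Proof.
move=> ef eg Pf Pg Mf Mg v; rewrite /serre_op.
rewrite !(lin, ef, eg, Pf, Pg, Mf, Mg).
linear_combination K; by field.
Qed.

(** The same cancellation when the extra terms come from the generator [g], which occurs once in
    each monomial. *)
Lemma serre_op_second :
  (forall v, e (f v) = x ^- 3 *: f' (e v)) ->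
  (forall v, e (g v) = g' (e v) + h *: (P v - M v)) ->
  (forall v, P (f v) = x *: f' (P v)) -> (forall v, M (f v) = x^-1 *: f' (M v)) ->
  forall v, e (serre_op (x ^+ 3) (x + x^-1) (x ^- 3) f g v)
          = x ^- 6 *: serre_op (x ^+ 3) (x + x^-1) (x ^- 3) f' g' (e v).
Proof.
move=> ef eg Pf Mf v; rewrite /serre_op.
rewrite !(lin, ef, eg, Pf, Mf).
linear_combination K; by field.
Qed.
Lemma serre_op_scaled (c1 t c3 a b : K) :
  (forall v, e (f v) = a *: f' (e v)) -> (forall v, e (g v) = b *: g' (e v)) ->
  forall v, e (serre_op c1 t c3 f g v) = (a ^+ 2 * b) *: serre_op c1 t c3 f' g' (e v).
Proof.
move=> ef eg v; rewrite /serre_op !(lin, ef, eg).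
linear_combination K; by ring.
Qed.

Lemma comm_scaled (y a b : K) :
  (forall v, e (f v) = a *: f' (e v)) -> (forall v, e (g v) = b *: g' (e v)) ->
  forall v, e (f (g v) - y *: g (f v)) = (a * b) *: (f' (g' (e v)) - y *: g' (f' (e v))).
Proof.
move=> ef eg v; rewrite !(lin, ef, eg).
linear_combination K; by ring.
Qed.

(** The extra term enters once from [f (g v)] and once, with factor [y * b], from [y *: g (f v)];
    these cancel as [y * b = 1]. *)
Lemma comm_first (y b : K) : y * b = 1 ->
  (forall v, e (f v) = f' (e v) + h *: (P v - M v)) -> (forall v, e (g v) = b *: g' (e v)) ->
  (forall v, P (g v) = g' (P v)) -> (forall v, M (g v) = g' (M v)) ->
  forall v, e (f (g v) - y *: g (f v)) = b *: (f' (g' (e v)) - y *: g' (f' (e v))).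
Proof.
move=> yb ef eg Pg Mg v; rewrite !(lin, ef, eg, Pg, Mg).
linear_combination K; rewrite ?mul0r ?mulr0 ?mulr1; ring: yb.
Qed.

Lemma comm_second (y : K) :
  (forall v, e (f v) = y *: f' (e v)) -> (forall v, e (g v) = g' (e v) + h *: (P v - M v)) ->
  (forall v, P (f v) = f' (P v)) -> (forall v, M (f v) = f' (M v)) ->
  forall v, e (f (g v) - y *: g (f v)) = y *: (f' (g' (e v)) - y *: g' (f' (e v))).
Proof.
move=> ef eg Pf Mf v; rewrite !(lin, ef, eg, Pf, Mf).
linear_combination K; by ring.
Qed.
End SerreOperators.

Section ElectricalSerre.
Variables (K : fieldType) (V : lmodType K).
Variables (f g f2 g2 z : {linear V -> V}) (x c : K).
Hypotheses (x0 : x != 0) (x2 : x ^+ 2 != 1).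
Local Notation h := ((x - x^-1)^-1).

Let lin := (lin_rules f, lin_rules g, lin_rules f2, lin_rules g2, lin_rules z).

(** The Serre relation oriented as a rewriting rule, which eliminates the monomial with [b]
    outermost. *)
Lemma serre_op_solve (y : K) (a b : V -> V) v : y != 0 ->
  serre_op (y ^+ 3) (x + x^-1) (y ^- 3) a b v = 0 ->
  b (a (a v)) = (y ^+ 3 * (x + x^-1)) *: a (b (a v)) + (- y ^+ 6) *: a (a (b v)).
Proof.
move=> y0; rewrite /serre_op => S0.
rewrite -[LHS]addr0 -(scaler0 _ (- y ^+ 3)) -S0.
linear_combination K; by field; rewrite x0 y0.
Qed.

(** The cross relations bring [f] and [f2] outside [g] and [g2]. The pure parts vanish by the Serre
    relations; the mixed cubic monomials and the terms in [z] cancel, and the part [h *: v] of the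
    relation between [g2] and [f] leaves the linear right-hand side. *)
Lemma electrical_serre_next :
  (forall v, g (f v) = x ^+ 2 *: f (g v)) ->
  (forall v, g2 (f2 v) = x ^+ 2 *: f2 (g2 v)) ->
  (forall v, g (f2 v) = x ^- 4 *: f2 (g v)) ->
  (forall v, g2 (f v) = x ^+ 2 *: (f (g2 v) + h *: (v - z v))) ->
  (forall v, z (f v) = x ^+ 4 *: f (z v)) ->
  (forall v, z (g v) = x ^+ 2 *: g (z v)) ->
  (forall v, serre_op (x ^+ 3) (x + x^-1) (x ^- 3) f f2 v = 0) ->
  (forall v, serre_op (x ^+ 3) (x + x^-1) (x ^- 3) g g2 v = 0) ->
  forall v, serre_op (x ^+ 3) (x + x^-1) (x ^- 3)
              (fun v => f v + c *: g v) (fun v => f2 v + c *: g2 v) v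
            = - (x * c * (x + x^-1)) *: (f v + c *: g v).
Proof.
move=> gf g2f2 gf2 g2f zf zg Sf Sg v; rewrite /serre_op.
have {}Sf w := serre_op_solve x0 (Sf w).
have {}Sg w := serre_op_solve x0 (Sg w).
rewrite !(lin, gf, g2f2, gf2, g2f, zf, zg, Sf, Sg).
linear_combination K; by field; rewrite x0 subr_eq0 -expr2.
Qed.

Lemma electrical_serre_prev :
  (forall v, g (f v) = x ^+ 2 *: f (g v)) ->
  (forall v, g2 (f2 v) = x ^+ 2 *: f2 (g2 v)) ->
  (forall v, g2 (f v) = x ^- 4 *: f (g2 v)) ->
  (forall v, g (f2 v) = x ^+ 2 *: (f2 (g v) + h *: (v - z v))) ->
  (forall v, z (f v) = x ^- 2 *: f (z v)) ->
  (forall v, z (g v) = x ^- 4 *: g (z v)) ->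
  (forall v, serre_op (x ^- 3) (x + x^-1) (x ^+ 3) f f2 v = 0) ->
  (forall v, serre_op (x ^- 3) (x + x^-1) (x ^+ 3) g g2 v = 0) ->
  forall v, serre_op (x ^- 3) (x + x^-1) (x ^+ 3)
              (fun v => f v + c *: g v) (fun v => f2 v + c *: g2 v) v
            = - (x * c * (x + x^-1)) *: (f v + c *: g v).
Proof.
move=> gf g2f2 g2f gf2 zf zg Sf0 Sg0 v; rewrite /serre_op.
(* With the exponents interchanged, the Serre relation is solved by taking the inverse of [x] for
   [y]. *)
have inv_rel (a b : V -> V) : (forall w, serre_op (x ^- 3) (x + x^-1) (x ^+ 3) a b w = 0) ->
    forall w, b (a (a w)) = (x ^- 3 * (x + x^-1)) *: a (b (a w)) + (- x ^- 6) *: a (a (b w)).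
  move=> S0 w; rewrite -!exprVn; apply: (serre_op_solve (y := x^-1) (a := a)).
    by rewrite invr_eq0.
  by rewrite !exprVn invrK.
have {}Sf := inv_rel _ _ Sf0; have {}Sg := inv_rel _ _ Sg0.
rewrite !(lin, gf, g2f2, gf2, g2f, zf, zg, Sf, Sg).
linear_combination K; by field; rewrite x0 subr_eq0 -expr2.
Qed.
Lemma electrical_comm (y : K) : y != 0 ->
  (forall v, f (f2 v) = y *: f2 (f v)) -> (forall v, g (g2 v) = y *: g2 (g v)) ->
  (forall v, g (f2 v) = y *: f2 (g v)) -> (forall v, g2 (f v) = y^-1 *: f (g2 v)) ->
  forall v, f (f2 v + c *: g2 v) + c *: g (f2 v + c *: g2 v)
          = y *: (f2 (f v + c *: g v) + c *: g2 (f v + c *: g v)).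
Proof.
move=> y0 ff gg gf2 g2f v; rewrite !(lin, ff, gg, gf2, g2f).
linear_combination K; by field.
Qed.
End ElectricalSerre.

Section TwistedSerre.
Variables (K : fieldType) (V : lmodType K).
Variables (a b ka kb : {linear V -> V}) (y s : K).

(** Moving all weight operators to the right costs the same scalar in each of the three monomials,
    because [ka] past [b] and [kb] past [a] give the same [s]. *)
Lemma serre_op_twist (c1 t c3 : K) :
  (forall v, ka (a v) = y *: a (ka v)) -> (forall v, ka (b v) = s *: b (ka v)) ->
  (forall v, kb (a v) = s *: a (kb v)) -> (forall v, kb (ka v) = ka (kb v)) ->
  forall v, serre_op c1 t c3 (fun v => a (ka v)) (fun v => b (kb v)) v
          = (y * s ^+ 2) *: serre_op c1 t c3 a b (ka (ka (kb v))).
Proof.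
move=> kaa kab kba kk v; rewrite /serre_op.
rewrite !(lin_rules a, lin_rules b, lin_rules ka, lin_rules kb, kaa, kab, kba, kk).
linear_combination K; by ring.
Qed.
End TwistedSerre.

(** * Weights *)

Lemma q_neq0 : q != 0.
Proof. by rewrite /q tofrac_eq0 polyX_eq0. Qed.

Lemma q_sqr_neq1 : q ^+ 2 != 1.
Proof.
rewrite /q -tofracXn -tofrac1 tofrac_eq -subr_eq0.
apply/eqP => /(congr1 (fun p : {poly rat} => p`_2)).
by rewrite coefB coefXn coef1 coef0.
Qed.

Lemma negpow_add1 n : negpow (n + 1) = - negpow n.
Proof. rewrite /negpow; rewrite /=; do ?case: ifP => ?; lia. Qed.

Lemma negpowB m n : negpow (m - n) = negpow m * negpow n.
Proof. rewrite /negpow; rewrite /=; do ?case: ifP => ?; lia. Qed.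

Lemma negpow_cases n : negpow n = 1 \/ negpow n = -1.
Proof. rewrite /negpow; rewrite /=; do ?case: ifP => ?; lia. Qed.

(** This is the pairing of [beta i] with the coroot of index [j], and its value is [bij j i]. The
    two boundary cases are those where one of the points [j], [j + 1] is [i] itself. *)
Lemma beta_step i j :
  beta i (j + 1) - beta i j =
  if (j == i) || (j + 1 == i) then -2 else 4 * sgz (i - j) * negpow (i - j).
Proof.
rewrite /beta negpowB.
have [->|ne_ji] := eqVneq j i.
  by rewrite negpow_add1; case: (negpow_cases i) => ->; rewrite /=; do ?case: ifP => ?; lia.
have [<-|ne_j1i] := eqVneq (j + 1) i.
  by rewrite negpow_add1; case: (negpow_cases j) => ->; rewrite /=; do ?case: ifP => ?; lia.
rewrite negpow_add1.
case: (negpow_cases i) => ->; case: (negpow_cases j) => ->.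
all: case: (sgzP (i - j)) => ?; rewrite /=; do ?case: ifP => ?; lia.
Qed.

Lemma betaijE i j :
  betaij i j = if j == i then 0 else if j == i + 1 then 3
               else if j + 1 == i then -3 else - 4 * sgz (j - i) * negpow (j - i).
Proof.
(* [lia] sees [negpow] as opaque, so its value in the boundary case is supplied. *)
have negpow_prev : j + 1 = i -> negpow (j - i) = -1.
  by move=> <-; have -> : j - (j + 1) = -1 by lia.
have := beta_step (i + 1) j.
rewrite /betaij /corootpair /wadd /gamma /wopp /alpha /epsw.
move: (beta (i + 1) (j + 1) : int) (beta (i + 1) j : int) => b1 b2.
have -> : i + 1 - j = - (j - i - 1) by lia.
move: negpow_prev; have := negpow_add1 (j - i - 1); rewrite subrK => ->.
have -> : negpow (- (j - i - 1)) = negpow (j - i - 1) by rewrite /negpow abszN.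
case: (sgzP (j - i)) => ?; case: (sgzP (- (j - i - 1))) => ?.
all: case: (negpow_cases (j - i - 1)) => ->.
all: rewrite /=; do ?case: ifP => ?; lia.
Qed.

Lemma betaij_diag i : betaij i i = 0.
Proof. by rewrite betaijE eqxx. Qed.

Lemma betaij_next i : betaij i (i + 1) = 3.
Proof. by rewrite betaijE; do ?case: ifP => ?; lia. Qed.

Lemma betaij_prev i : betaij (i + 1) i = -3.
Proof. by rewrite betaijE; do ?case: ifP => ?; lia. Qed.

Lemma betaij_far i j : 1 < `|i - j| -> betaij i j = - Defs.bij i j.
Proof. by move=> ?; rewrite betaijE /Defs.bij; do ?case: ifP => ?; try lia; by rewrite !mulNr. Qed.

(** This symmetry allows the roles of [E] and [F] to be exchanged: solved for [F_j E_i], the mixed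
    relation has the exponent [betaij j i]. *)
Lemma betaij_antisym i j : betaij j i = - betaij i j.
Proof.
rewrite !betaijE.
have -> : negpow (i - j) = negpow (j - i) by rewrite /negpow distnC.
have -> : sgz (i - j) = - sgz (j - i) by rewrite -sgzN opprB.
by do ?case: ifP => ?; lia.
Qed.

Lemma corootpair_alpha i j :
  corootpair (alpha i) j = if j == i then 2
    else if (j == i + 1) || (j + 1 == i) then -1 else 0.
Proof. by rewrite /corootpair /alpha /epsw; (do ?case: ifP => ?); try lia; rewrite /=; lia. Qed.

Lemma corootpair_opp l i : corootpair (wopp l) i = - corootpair l i.
Proof. by rewrite /corootpair /wopp opprB opprK addrC. Qed.

Lemma corootpair_add l m i : corootpair (wadd l m) i = corootpair l i + corootpair m i.
Proof. by rewrite /corootpair /wadd opprD addrACA. Qed.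

(** * The relations of El in a U-module *)

Lemma bij_shift i j : Defs.bij (i - 1) (j - 1) = Defs.bij i j.
Proof.
rewrite /Defs.bij; have -> : j - 1 - (i - 1) = j - i by lia.
have -> : (j - 1 == i - 1) = (j == i) by lia.
by have -> : (j - 1 == i - 1 + 1) = (j == i + 1) by lia.
Qed.

Lemma far_sym (i j : int) : 1 < `|i - j| -> 1 < `|j - i|.
Proof. by rewrite distrC. Qed.

Lemma bij_antisym i j : 1 < `|i - j| -> Defs.bij j i = - Defs.bij i j.
Proof.
by move=> ij; rewrite -(betaij_far ij) (betaij_antisym j i) (betaij_far (far_sym ij)) opprK.
Qed.

Lemma corootpair_alpha_far i j : 1 < `|i - j| -> corootpair (alpha i) j = 0.
Proof. by move=> ?; rewrite corootpair_alpha; (do ?case: ifP => ?); lia. Qed.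

(** The exponent for moving [E_{i-1} K_{-alpha_{i-1}}] past [F_j] agrees with the one for [F_i] past
    [F_j], so both summands of [j_gen] scale alike. At [j = i - 2] the two terms are -1 and -3. *)
Lemma corootpair_betaij_far i j : 1 < `|i - j| ->
  corootpair (alpha (i - 1)) j + betaij (i - 1) j = Defs.bij i j.
Proof.
move=> ij; rewrite corootpair_alpha betaijE /Defs.bij.
have n2 : j + 1 = i - 1 -> negpow (j - i) = 1 by move=> ?; have -> : j - i = -2 by lia.
have -> : negpow (j - (i - 1)) = - negpow (j - i).
  by rewrite -negpow_add1; congr negpow; lia.
case: (negpow_cases (j - i)) n2 => -> n2.
all: case: (sgzP (j - (i - 1))) => ?; case: (sgzP (j - i)) => ?; try lia.
all: (do ?case: ifP => ?); try lia; rewrite /=; lia.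
Qed.

Lemma qzD m n : q ^ (m + n) = q ^ m * q ^ n.
Proof. exact/expfzDr/q_neq0. Qed.

Lemma q_unit m : q ^ m != 0.
Proof. exact/expfz_neq0/q_neq0. Qed.

Section UModule.
Variables (V : lmodType Kf) (rho : Ugen -> {linear V -> V}).
Hypothesis relV : forall s t v, Defs.relU s t -> act rho s v = act rho t v.
Local Notation Eo i := (rho (UE i)).
Local Notation Fo i := (rho (UF i)).
Local Notation Ko l := (rho (UK l)).
Local Notation h := ((q - q^-1)^-1).

Lemma Ko_add l m v : Ko l (Ko m v) = Ko (wadd l m) v.
Proof. exact: (relV v (rU_KK l m)). Qed.

Lemma Ko_ext l m v : (forall j, l j = m j) -> Ko l v = Ko m v.
Proof. by move=> lm; apply: (relV v (rU_Kext lm)). Qed.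

Lemma Ko0 v : Ko w0 v = v.
Proof. by rewrite [LHS](relV v rU_K0) /= scale1r. Qed.

Lemma Ko_comm l m v : Ko l (Ko m v) = Ko m (Ko l v).
Proof. by rewrite !Ko_add; apply: Ko_ext => j; rewrite /wadd addrC. Qed.

Lemma Ko_opp l v : Ko l (Ko (wopp l) v) = v.
Proof. by rewrite Ko_add -[RHS]Ko0; apply: Ko_ext => j; rewrite /wadd /wopp subrr. Qed.

Lemma KoF l i v : Ko l (Fo i v) = q ^ (- corootpair l i) *: Fo i (Ko l v).
Proof. exact: (relV v (rU_KF l i)). Qed.

Lemma KoE l i v : Ko l (Eo i v) = q ^ corootpair l i *: Eo i (Ko l v).
Proof. exact: (relV v (rU_KE l i)). Qed.

Lemma EoF i j v : Eo i (Fo j v) = q ^ betaij i j *: Fo j (Eo i v)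
  + (if i == j then h *: (Ko (alpha i) v - Ko (wopp (alpha i)) v) else 0).
Proof.
have /= := relV v (rU_EF i j); rewrite scaleN1r => /(canRL (subrK _)) ->.
rewrite addrC; congr (_ + _).
by case: (i == j) => /=; rewrite ?scale0r // scaleN1r.
Qed.

Lemma FoF i j v : 1 < `|i - j| -> Fo i (Fo j v) = q ^ Defs.bij i j *: Fo j (Fo i v).
Proof. by move=> ij; apply: (relV v (rU_FF ij)). Qed.

Lemma EoE i j v : 1 < `|i - j| -> Eo i (Eo j v) = q ^ Defs.bij i j *: Eo j (Eo i v).
Proof. by move=> ij; apply: (relV v (rU_EE ij)). Qed.

Lemma FoS1 i v : serre_op (q ^ 3) q2 (q ^ (-3)) (Fo i) (Fo (i + 1)) v = 0.
Proof. by rewrite [LHS](relV v (rU_FS1 i)) /= scale0r. Qed.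
Lemma FoS2 i v : serre_op (q ^ (-3)) q2 (q ^ 3) (Fo i) (Fo (i - 1)) v = 0.
Proof. by rewrite [LHS](relV v (rU_FS2 i)) /= scale0r. Qed.
Lemma EoS1 i v : serre_op (q ^ 3) q2 (q ^ (-3)) (Eo i) (Eo (i + 1)) v = 0.
Proof. by rewrite [LHS](relV v (rU_ES1 i)) /= scale0r. Qed.
Lemma EoS2 i v : serre_op (q ^ (-3)) q2 (q ^ 3) (Eo i) (Eo (i - 1)) v = 0.
Proof. by rewrite [LHS](relV v (rU_ES2 i)) /= scale0r. Qed.

(** Up to a scalar, the second summand of [j_gen eps (i + 1)]. *)
Definition Go (i : int) : {linear V -> V} :=
  act rho (tMul (tG (UE i)) (tG (UK (wopp (alpha i))))).
Definition Zo (i : int) : {linear V -> V} :=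
  rho (UK (wadd (wopp (alpha i)) (wopp (alpha i)))).

Lemma GoE i v : Go i v = Eo i (Ko (wopp (alpha i)) v).
Proof. by []. Qed.

(** Moving [K_{-alpha_i}] past [F_j] adds the Cartan pairing to the exponent. On the diagonal it
    also turns [K_{alpha_i} - K_{-alpha_i}] into the identity minus [Zo i]. *)
Lemma GoF i j v : Go i (Fo j v) =
  q ^ (corootpair (alpha i) j + betaij i j) *: Fo j (Go i v)
  + (if i == j then q ^+ 2 *: (h *: (v - Zo i v)) else 0).
Proof.
rewrite !GoE KoF corootpair_opp opprK lin_Z EoF scalerDr scalerA -qzD.
congr (_ + _); case: eqP => [<-|_]; last by rewrite scaler0.
by rewrite corootpair_alpha eqxx Ko_opp Ko_add.
Qed.

Lemma Go_comm i j v : 1 < `|i - j| -> Go i (Go j v) = q ^ Defs.bij i j *: Go j (Go i v).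
Proof.
move=> ij; rewrite !GoE !KoE !corootpair_opp !corootpair_alpha_far //; last exact: far_sym.
by rewrite !oppr0 !expr0z !scale1r EoE // Ko_comm.
Qed.

Lemma Go_serre c1 c3 i j v : i + 1 = j \/ j + 1 = i ->
  (forall v, serre_op c1 q2 c3 (Eo i) (Eo j) v = 0) ->
  serre_op c1 q2 c3 (Go i) (Go j) v = 0.
Proof.
move=> ij S0; rewrite (serre_op_twist (a := Eo i) (b := Eo j) _ _ _
  (fun v => KoE (wopp (alpha i)) i v) (fun v => KoE (wopp (alpha i)) j v)
  (s := q ^ (corootpair (wopp (alpha i)) j)) _ _).
- by rewrite S0 scaler0.
- move=> w; rewrite KoE !corootpair_opp !corootpair_alpha; congr (q ^ (- _) *: _).
  by (do ?case: ifP => ?) => //=; lia.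
- by move=> w; rewrite Ko_comm.
Qed.

Lemma GoF_neq i j v m : i <> j -> corootpair (alpha i) j + betaij i j = m ->
  Go i (Fo j v) = q ^ m *: Fo j (Go i v).
Proof. by move=> /eqP/negPf ne_ij <-; rewrite GoF ne_ij addr0. Qed.

Lemma GoF_diag i v : Go i (Fo i v) = q ^+ 2 *: (Fo i (Go i v) + h *: (v - Zo i v)).
Proof. by rewrite GoF eqxx corootpair_alpha eqxx betaij_diag addr0 -scalerDr. Qed.

Lemma GoF_succ i v : Go i (Fo (i + 1) v) = q ^+ 2 *: Fo (i + 1) (Go i v).
Proof.
apply: (@GoF_neq _ _ _ (2)); first by lia.
by rewrite betaij_next corootpair_alpha; (do ?case: ifP => ?) => /=; lia.
Qed.

Lemma ZoF i j v m : 2 * corootpair (alpha i) j = m -> Zo i (Fo j v) = q ^ m *: Fo j (Zo i v).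
Proof.
by move=> <-; rewrite /Zo KoF corootpair_add corootpair_opp; congr (q ^ _ *: _); lia.
Qed.

Lemma ZoG i j v m : - 2 * corootpair (alpha i) j = m -> Zo i (Go j v) = q ^ m *: Go j (Zo i v).
Proof.
move=> <-; rewrite !GoE /Zo KoE corootpair_add corootpair_opp Ko_comm.
by congr (q ^ _ *: _); lia.
Qed.

Lemma distance_two_exponent i j : j - i = 2 ->
  corootpair (alpha i) j + betaij i j = -4.
Proof.
move=> ij; rewrite corootpair_alpha betaijE; (do ?case: ifP => ?) => /=; try lia.
by rewrite ij.
Qed.

(** Stated for any module over [U]: applied to [U] itself it shows that [j] is well defined, and
    applied to the Verma module it makes that a module over [El]. *)
Lemma electrical_rel eps s t v : relEl eps s t ->
  act (fun i => act rho (j_gen eps i) : {linear V -> V}) s v =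
  act (fun i => act rho (j_gen eps i) : {linear V -> V}) t v.
Proof.
(* The sum of operators with coefficient [c] has right-hand side scalar [- (q * c * q2)]; this fixes
   [c] as [q ^ (eps - 1)]. *)
have cE : q ^ eps * q2 = q * q ^ (eps - 1) * q2.
  by congr (_ * _); rewrite mulrC -[q in RHS]expr1z -qzD subrK.
case=> [i j ij|i|i].
- apply: (@electrical_comm _ _ (Fo i) (Go (i - 1)) (Fo j) (Go (j - 1)) _ (q ^ Defs.bij i j)) v.
  + exact: q_unit.
  + by move=> w; apply: FoF.
  + by move=> w; rewrite Go_comm ?bij_shift //; lia.
  + move=> w; rewrite GoF corootpair_betaij_far //; case: eqP => [?|_]; first by lia.
    by rewrite addr0.
  + move=> w; rewrite GoF corootpair_betaij_far; last exact: far_sym.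
    case: eqP => [?|_]; first by lia.
    by rewrite addr0 bij_antisym // -invr_expz.
- rewrite [RHS]/= cE.
  apply: (@electrical_serre_next _ _ (Fo i) (Go (i - 1)) (Fo (i + 1)) (Go (i + 1 - 1)) (Zo i)).
  + exact: q_neq0.
  + exact: q_sqr_neq1.
  + by move=> w; rewrite -[in Fo i _](subrK 1 i) GoF_succ subrK.
  + by move=> w; rewrite addrK GoF_succ.
  + by move=> w; apply: (@GoF_neq _ _ _ (-4)); [lia | apply: distance_two_exponent; lia].
  + by move=> w; rewrite addrK GoF_diag.
  + by move=> w; apply: (@ZoF _ _ _ (4)); rewrite corootpair_alpha eqxx.
  + move=> w; apply: (@ZoG _ _ _ (2)); rewrite corootpair_alpha.
    by (do ?case: ifP => ?) => /=; lia.
  + by move=> w; apply: FoS1.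
  + move=> w; rewrite addrK; apply: Go_serre => [|u]; first by lia.
    by rewrite -[in Eo i](subrK 1 i); apply: EoS1.
- rewrite [RHS]/= cE.
  apply: (@electrical_serre_prev _ _ (Fo i) (Go (i - 1)) (Fo (i - 1)) (Go (i - 1 - 1)) (Zo (i - 1))).
  + exact: q_neq0.
  + exact: q_sqr_neq1.
  + by move=> w; rewrite -[in Fo i _](subrK 1 i) GoF_succ subrK.
  + by move=> w; rewrite -[in Fo (i - 1) _](subrK 1 (i - 1)) GoF_succ subrK.
  + by move=> w; apply: (@GoF_neq _ _ _ (-4)); [lia | apply: distance_two_exponent; lia].
  + by move=> w; rewrite GoF_diag.
  + move=> w; apply: (@ZoF _ _ _ (-2)); rewrite corootpair_alpha.
    by (do ?case: ifP => ?) => /=; lia.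
  + by move=> w; apply: (@ZoG _ _ _ (-4)); rewrite corootpair_alpha eqxx.
  + by move=> w; apply: FoS2.
  + by move=> w; apply: Go_serre => [|u]; [lia | apply: EoS2].
Qed.
End UModule.

(** * Intertwining the relations of the negative part *)

(* The relations among the [F_i] in [U]; they present its negative part. *)
Inductive relN : term int -> term int -> Prop :=
| rN_comm i j : 1 < `|i - j| ->
    relN (tMul (tG i) (tG j)) (tScale (q ^ Defs.bij i j) (tMul (tG j) (tG i)))
| rN_S1 i : relN (serre (q ^ 3) (q ^ (-3)) (tG i) (tG (i + 1))) t0
| rN_S2 i : relN (serre (q ^ (-3)) (q ^ 3) (tG i) (tG (i - 1))) t0.

Section Intertwiner.
Variables (V V' : lmodType Kf) (e P M : {linear V -> V'}).
Variables (f : int -> {linear V -> V}) (f' : int -> {linear V' -> V'}).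
Variables (k : int) (h : Kf).
Hypothesis ef : forall j v, e (f j v) = q ^ betaij k j *: f' j (e v)
  + (if k == j then h *: (P v - M v) else 0).
Hypothesis Pf : forall j v, P (f j v) = q ^ (- corootpair (alpha k) j) *: f' j (P v).
Hypothesis Mf : forall j v, M (f j v) = q ^ corootpair (alpha k) j *: f' j (M v).

Let ef_neq j v : k <> j -> e (f j v) = q ^ betaij k j *: f' j (e v).
Proof. by move=> /eqP/negPf ne_kj; rewrite ef ne_kj addr0. Qed.

Let ef_eq v : e (f k v) = f' k (e v) + h *: (P v - M v).
Proof. by rewrite ef eqxx betaij_diag expr0z scale1r. Qed.

Let sym_h v : h *: (P v - M v) = (- h) *: (M v - P v).
Proof. by rewrite scaleNr -scalerN opprB. Qed.

(** Used twice: with [e] the second projection of pairs, to construct [E_k], and with [e] equal to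
    [F_k] and the [E_j] as the family [f], to transfer relations to the [E_j]. The second use
    divides by [c]. *)
Lemma relN_intertwine s t : relN s t ->
  exists2 c : Kf, c != 0 &
    forall v, e (act f s v - act f t v) = c *: (act f' s (e v) - act f' t (e v)).
Proof.
have subS0 (W : lmodType Kf) (x w : W) : x - 0 *: w = x by rewrite scale0r subr0.
case=> [i j ij|i|i] /=.
- have [ki|/eqP ki] := eqVneq k i.
    exists (q ^ betaij k j); first exact: q_unit.
    subst k; apply: (@comm_first _ _ _ e P M (f i) (f j) (f' i) (f' j) h).
    + by rewrite betaij_far // -qzD subrr.
    + exact: ef_eq.
    + by move=> w; apply: ef_neq; lia.
    + by move=> w; rewrite Pf corootpair_alpha_far // oppr0 expr0z scale1r.
    + by move=> w; rewrite Mf corootpair_alpha_far // expr0z scale1r.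
  have [kj|/eqP kj] := eqVneq k j.
    exists (q ^ Defs.bij i j); first exact: q_unit.
    have ji := far_sym ij.
    subst k; apply: (@comm_second _ _ _ e P M (f i) (f j) (f' i) (f' j) h).
    + by move=> w; rewrite ef_neq // betaij_far // bij_antisym // opprK.
    + exact: ef_eq.
    + by move=> w; rewrite Pf corootpair_alpha_far // oppr0 expr0z scale1r.
    + by move=> w; rewrite Mf corootpair_alpha_far // expr0z scale1r.
  exists (q ^ betaij k i * q ^ betaij k j); first by rewrite mulf_neq0 ?q_unit.
  by apply: comm_scaled => w; apply: ef_neq.
- have [ki|/eqP ki] := eqVneq k i.
    exists (q ^ 3); first exact: q_unit.
    move=> v; rewrite !subS0.
    subst k; apply: (@serre_op_first _ _ _ e P M (f i) (f (i + 1)) (f' i) (f' (i + 1)) q h).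
    + exact: q_neq0.
    + exact: ef_eq.
    + by move=> w; rewrite ef_neq ?betaij_next //; lia.
    + by move=> w; rewrite Pf corootpair_alpha eqxx.
    + by move=> w; rewrite Pf corootpair_alpha; (do ?case: ifP => ?); try lia.
    + by move=> w; rewrite Mf corootpair_alpha eqxx.
    + by move=> w; rewrite Mf corootpair_alpha; (do ?case: ifP => ?); try lia.
  have [kj|/eqP kj] := eqVneq k (i + 1).
    exists (q ^ (-6)); first exact: q_unit.
    move=> v; rewrite !subS0.
    apply: (@serre_op_second _ _ _ e P M (f i) (f (i + 1)) (f' i) (f' (i + 1)) q h).
    + exact: q_neq0.
    + by move=> w; rewrite ef_neq // kj betaij_prev.
    + by move=> w; rewrite -kj ef_eq.
    + by move=> w; rewrite Pf corootpair_alpha; (do ?case: ifP => ?); try lia.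
    + by move=> w; rewrite Mf corootpair_alpha; (do ?case: ifP => ?); try lia.
  exists ((q ^ betaij k i) ^+ 2 * q ^ betaij k (i + 1)).
    by rewrite mulf_neq0 ?expf_neq0 ?q_unit.
  move=> v; rewrite !subS0.
  by apply: serre_op_scaled => w; apply: ef_neq.
(* The second Serre relation is the first one at the inverse of [q], with [P] and [M] exchanged and
   [h] negated. *)
- have q3 : q ^ (-3) = q^-1 ^+ 3 by rewrite exprVn.
  have q3V : q ^ 3 = q^-1 ^- 3 by rewrite exprVn invrK.
  have q2V : q2 = q^-1 + q^-1^-1 by rewrite invrK addrC.
  have b_pred : betaij i (i - 1) = -3 by have := betaij_prev (i - 1); rewrite subrK.
  have b_next : betaij (i - 1) i = 3 by have := betaij_next (i - 1); rewrite subrK.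
  have qV0 : q^-1 != 0 by rewrite invr_eq0 q_neq0.
  have [ki|/eqP ki] := eqVneq k i.
    exists (q^-1 ^+ 3); first by rewrite expf_neq0.
    move=> v; rewrite !subS0 q3 q3V q2V.
    subst k; apply: (@serre_op_first _ _ _ e M P (f i) (f (i - 1)) (f' i) (f' (i - 1)) q^-1 (- h)).
    + exact: qV0.
    + by move=> w; rewrite ef_eq sym_h.
    + by move=> w; rewrite ef_neq; [rewrite b_pred q3 | lia].
    + by move=> w; rewrite Mf corootpair_alpha eqxx exprVn invrK.
    + by move=> w; rewrite Mf corootpair_alpha; (do ?case: ifP => ?); try lia.
    + by move=> w; rewrite Pf corootpair_alpha eqxx exprVn.
    + by move=> w; rewrite Pf corootpair_alpha invrK; (do ?case: ifP => ?); try lia.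
  have [kj|/eqP kj] := eqVneq k (i - 1).
    exists (q^-1 ^- 6); first by rewrite invr_eq0 expf_neq0.
    move=> v; rewrite !subS0 q3 q3V q2V.
    apply: (@serre_op_second _ _ _ e M P (f i) (f (i - 1)) (f' i) (f' (i - 1)) q^-1 (- h)).
    + exact: qV0.
    + by move=> w; rewrite ef_neq // kj b_next q3V.
    + by move=> w; rewrite -kj ef_eq sym_h.
    + by move=> w; rewrite Mf corootpair_alpha; (do ?case: ifP => ?); try lia.
    + by move=> w; rewrite Pf corootpair_alpha invrK; (do ?case: ifP => ?); try lia.
  exists ((q ^ betaij k i) ^+ 2 * q ^ betaij k (i - 1)).
    by rewrite mulf_neq0 ?expf_neq0 ?q_unit.
  move=> v; rewrite !subS0.
  by apply: serre_op_scaled => w; apply: ef_neq.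
Qed.
End Intertwiner.

(** * The Verma module *)

Local Notation N := (palg relN).
Local Notation Fn i := (@pgen int relN i).
Local Notation h := ((q - q^-1)^-1).

Lemma relN_pgen s t (v : N) : relN s t -> act pgen s v = act pgen t v.
Proof. by move=> st; apply/act_pgen_sound/pe_rel. Qed.

Section WeightOperator.
Variable l : weight.

Definition Kgen (i : int) : {linear N -> N} :=
  act pgen (tScale (q ^ (- corootpair l i)) (tG i)).

(** Each relation is homogeneous in every generator, so rescaling the generators preserves it; the
    scaling lemmas apply with [e] the identity. *)
Lemma relN_Kgen s t v : relN s t -> act Kgen s v = act Kgen t v.
Proof.
have sc i u : idfun (Kgen i u) = q ^ (- corootpair l i) *: Fn i (idfun u) by [].
case=> [i j ij|i|i].
- apply/subr0_eq; rewrite [LHS](comm_scaled (e := idfun) _ (sc i) (sc j)).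
  by have /= -> := relN_pgen v (rN_comm ij); rewrite subrr scaler0.
- rewrite [LHS](serre_op_scaled (e := idfun) _ _ _ (sc i) (sc (i + 1))).
  by have /= := relN_pgen v (rN_S1 i); rewrite !scale0r => S0; rewrite [serre_op _ _ _ _ _ _]S0 scaler0.
- rewrite [LHS](serre_op_scaled (e := idfun) _ _ _ (sc i) (sc (i - 1))).
  by have /= := relN_pgen v (rN_S2 i); rewrite !scale0r => S0; rewrite [serre_op _ _ _ _ _ _]S0 scaler0.
Qed.

Definition Kn : {linear N -> N} := locked (plift pone relN_Kgen).

Lemma Kn1 : Kn pone = pone. Proof. by rewrite /Kn -lock plift1. Qed.
Lemma KnF i v : Kn (Fn i v) = q ^ (- corootpair l i) *: Fn i (Kn v).
Proof. by rewrite /Kn -lock plift_gen. Qed.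
End WeightOperator.

Section LoweringOperator.
Variable k : int.

Definition Hn (v : N) : N := h *: (Kn (alpha k) v - Kn (wopp (alpha k)) v).

(** A pair is to be read as [(v, E_k v)]; the second entry follows the rule for moving [E_k] past
    [F_j]. *)
Definition Ggen_fun (j : int) (w : N * N) : N * N :=
  (Fn j w.1, q ^ betaij k j *: Fn j w.2 + (if k == j then Hn w.1 else 0)).

Lemma Ggen_is_linear j : linear (Ggen_fun j).
Proof.
move=> c [u1 u2] [w1 w2]; congr pair; first exact: linearP.
change (q ^ betaij k j *: Fn j (c *: u2 + w2) + (if k == j then Hn (c *: u1 + w1) else 0)
  = c *: (q ^ betaij k j *: Fn j u2 + (if k == j then Hn u1 else 0))
    + (q ^ betaij k j *: Fn j w2 + (if k == j then Hn w1 else 0))).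
case: (k == j); rewrite /Hn !(lin_rules (Fn j), lin_rules (Kn _)).
all: move: (Fn j u2) (Fn j w2) (Kn (alpha k) u1) (Kn (alpha k) w1) => x1 x2 x3 x4.
all: move: (Kn (wopp (alpha k)) u1) (Kn (wopp (alpha k)) w1) => x5 x6.
all: by linear_combination Kf; ring.
Qed.
HB.instance Definition _ j :=
  GRing.isLinear.Build Kf (N * N)%type (N * N)%type _ (Ggen_fun j) (Ggen_is_linear j).
Definition Ggen j : {linear (N * N)%type -> (N * N)%type} := Ggen_fun j.

Lemma act_Ggen_fst s w : (act Ggen s w).1 = act pgen s w.1.
Proof.
by elim: s w => [c|j|a IHa b IHb|a IHa b IHb] w //=; rewrite ?IHa ?IHb.
Qed.

Lemma relN_Ggen s t w : relN s t -> act Ggen s w = act Ggen t w.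
Proof.
move=> st; rewrite [LHS]surjective_pairing [RHS]surjective_pairing; congr pair.
  by rewrite !act_Ggen_fst; apply: relN_pgen.
pose P : {linear (N * N)%type -> N} := Kn (alpha k) \o fst.
pose M : {linear (N * N)%type -> N} := Kn (wopp (alpha k)) \o fst.
have [|||c _ Ec] := @relN_intertwine _ _ snd P M Ggen (fun j => Fn j) k h _ _ _ s t st.
- by [].
- by move=> j v; rewrite /P /= KnF.
- by move=> j v; rewrite /M /= KnF corootpair_opp opprK.
apply/subr0_eq; rewrite -linearB /= [LHS]Ec.
by rewrite (relN_pgen _ st) subrr scaler0.
Qed.

Definition En_pair : {linear N -> (N * N)%type} := plift (pone, 0) relN_Ggen.

Lemma En_pair_fst v : (En_pair v).1 = v.
Proof.
elim/palg_ind: v => [|x y IHx IHy|c x IHx|g x IHx].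
- by rewrite /En_pair plift1.
- by rewrite linearD /= IHx IHy.
- by rewrite linearZ /= IHx.
- by rewrite /En_pair plift_gen /= IHx.
Qed.

Definition En : {linear N -> N} := locked (snd \o En_pair : {linear N -> N}).

Lemma En1 : En pone = 0.
Proof. by rewrite /En -lock /= /En_pair plift1. Qed.

Lemma EnF j v : En (Fn j v) = q ^ betaij k j *: Fn j (En v) + (if k == j then Hn v else 0).
Proof. by rewrite /En -lock /= /En_pair plift_gen /= -/En_pair En_pair_fst. Qed.
End LoweringOperator.

Lemma palg_ind_lin (W : lmodType Kf) (a b : {linear N -> W}) :
  a pone = b pone -> (forall g x, a x = b x -> a (Fn g x) = b (Fn g x)) ->
  forall x, a x = b x.
Proof.
move=> ab1 abF; elim/palg_ind => [|x y IHx IHy|c x IHx|g x] //; last exact: abF.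
- by rewrite !lin_D IHx IHy.
- by rewrite !lin_Z IHx.
Qed.

Lemma Kn_add l m v : Kn l (Kn m v) = Kn (wadd l m) v.
Proof.
apply: (palg_ind_lin (a := Kn l \o Kn m)) v => [|g x /= IH]; first by rewrite /= !Kn1.
by rewrite !KnF !lin_Z !KnF scalerA IH mulrC -qzD -opprD corootpair_add.
Qed.

Lemma Kn_ext l m v : (forall j, l j = m j) -> Kn l v = Kn m v.
Proof.
move=> lm; apply: palg_ind_lin v => [|g x IH]; first by rewrite !Kn1.
by rewrite !KnF IH /corootpair !lm.
Qed.

Lemma Kn_comm l m v : Kn l (Kn m v) = Kn m (Kn l v).
Proof. by rewrite !Kn_add; apply: Kn_ext => j; rewrite /wadd addrC. Qed.

Lemma Kn0 v : Kn w0 v = v.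
Proof.
apply: (palg_ind_lin (b := idfun)) v => [|g x /= IH]; first by rewrite Kn1.
by rewrite KnF IH expr0z scale1r.
Qed.

Lemma KnE l i v : Kn l (En i v) = q ^ corootpair l i *: En i (Kn l v).
Proof.
apply: (palg_ind_lin (a := Kn l \o En i) (b := q ^ corootpair l i \*: (En i \o Kn l))) v
  => [|g x /= IH]; first by rewrite /= Kn1 En1 linear0 scaler0.
rewrite EnF lin_D lin_Z KnF IH KnF (lin_Z (En i)) EnF (lin_Z (Fn g)) !scalerDr !scalerA.
congr (_ *: _ + _); first by rewrite -!qzD; congr (q ^ _); lia.
case: eqP => [<-|_]; last by rewrite linear0 scaler0.
rewrite /Hn lin_Z lin_D lin_N Kn_comm [Kn l (Kn (wopp _) x)]Kn_comm.
by rewrite -qzD addrN expr0z scale1r.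
Qed.

Definition rhoN (g : Ugen) : {linear N -> N} :=
  match g with UE i => En i | UF i => Fn i | UK l => Kn l end.

(** Induction on the vector: every [E_j] kills the unit, and by [relN_intertwine] the defect at
    [F_k x] is, up to a nonzero scalar, [F_k] applied to the defect at [x]. *)
Lemma relN_En s t v : relN s t -> act En s v = act En t v.
Proof.
move=> st; apply: (palg_ind_lin (a := act En s) (b := act En t)) v => [|k x IH].
  by case: st => [i j _|i|i] /=; rewrite !En1 ?linear0 ?scaler0 ?scale0r ?addr0.
have [|||c c0 Fc] := @relN_intertwine _ _ (Fn k) (Kn (wopp (alpha k))) (Kn (alpha k))
  En En k h _ _ _ s t st.
- move=> j u; rewrite EnF scalerDr scalerA -qzD (betaij_antisym k j) addrN expr0z scale1r.
  rewrite eq_sym; case: eqP => [<-|_]; last by rewrite scaler0 !addr0.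
  rewrite betaij_diag expr0z scale1r /Hn -addrA -scalerDr.
  by rewrite -[Kn (wopp _) u - _]opprB subrr scaler0 addr0.
- by move=> j u; rewrite KnE corootpair_opp.
- by move=> j u; rewrite KnE.
apply/subr0_eq/eqP; have := Fc x; rewrite [act En s x]IH subrr linear0 => /esym/eqP.
by rewrite scaler_eq0 (negPf c0).
Qed.

Lemma relU_rhoN s t v : Defs.relU s t -> act rhoN s v = act rhoN t v.
Proof.
have E_rel s' t' : relN s' t' -> act rhoN (tmap (fun i => tG (UE i)) s') v
                               = act rhoN (tmap (fun i => tG (UE i)) t') v.
  by move=> st; rewrite !act_tmap; apply: relN_En.
have F_rel s' t' : relN s' t' -> act rhoN (tmap (fun i => tG (UF i)) s') v
                               = act rhoN (tmap (fun i => tG (UF i)) t') v.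
  by move=> st; rewrite !act_tmap; apply: relN_pgen.
case=> [l m||l m lm|l i|l i|i j|i j ij|i j ij|i|i|i|i].
- exact: Kn_add.
- by rewrite /= Kn0 scale1r.
- exact: Kn_ext.
- exact: KnF.
- exact: KnE.
- rewrite /= EnF scaleN1r addrC addKr; case: (i == j); last by rewrite /= scale0r.
  by rewrite /= scaleN1r.
- exact: (F_rel _ _ (rN_comm ij)).
- exact: (E_rel _ _ (rN_comm ij)).
- exact: (F_rel _ _ (rN_S1 i)).
- exact: (F_rel _ _ (rN_S2 i)).
- exact: (E_rel _ _ (rN_S1 i)).
- exact: (E_rel _ _ (rN_S2 i)).
Qed.

(** * Filtrations and injectivity *)

Section Filtration.
Variables (G : Type) (R : term G -> term G -> Prop).

(** The index is shifted by one: [filt n] is spanned by products of fewer than [n] generators. Thus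
    [filt 0] is zero, and degree [k] lives in [filt k.+1] modulo [filt k]. *)
Inductive filt : nat -> palg R -> Prop :=
| filt0 n : filt n 0
| filt1 n : filt n.+1 pone
| filtD n x y : filt n x -> filt n y -> filt n (x + y)
| filtZ n c x : filt n x -> filt n (c *: x)
| filt_gen n g x : filt n x -> filt n.+1 (pgen g x).

Lemma filt_le m n x : (m <= n)%N -> filt m x -> filt n x.
Proof.
move=> le_mn fx; elim: fx n le_mn => {m x} [m|m|m x y _ IHx _ IHy|m c x _ IH|m g x _ IH] [|n] //.
all: move=> le_mn; try by constructor; auto.
Qed.

Lemma filtN n x : filt n x -> filt n (- x).
Proof. by move=> fx; rewrite -scaleN1r; apply: filtZ. Qed.

Lemma filtB n x y : filt n x -> filt n y -> filt n (x - y).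
Proof. by move=> fx fy; apply/filtD/filtN. Qed.

Lemma filt_bottom x : filt 0 x -> x = 0.
Proof.
move=> fx; have: 0%N = 0%N by []; move: fx; move: {1 3}0%N => n fx.
elim: fx => {n x} [//|//|n x y _ IHx _ IHy /[dup] /IHx -> /IHy ->|n c x _ IHx /IHx ->|//].
  by rewrite addr0.
by rewrite scaler0.
Qed.

Lemma filt_exhaustive x : exists n, filt n x.
Proof.
elim/palg_ind: x => [|x y [m fx] [n fy]|c x [n fx]|g x [n fx]].
- by exists 1%N; apply: filt1.
- exists (maxn m n); apply: filtD.
    exact: filt_le (leq_maxl m n) fx.
  exact: filt_le (leq_maxr m n) fy.
- by exists n; apply: filtZ.
- by exists n.+1; apply: filt_gen.
Qed.
End Filtration.

Lemma filt_Kn n l (v : N) : filt n v -> filt n (Kn l v).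
Proof.
elim=> {n v} [n|n|n x y _ IHx _ IHy|n c x _ IH|n g x _ IH].
- by rewrite linear0; apply: filt0.
- by rewrite Kn1; apply: filt1.
- by rewrite lin_D; apply: filtD.
- by rewrite lin_Z; apply: filtZ.
- by rewrite KnF; apply/filtZ/filt_gen.
Qed.

Lemma filt_En n k (v : N) : filt n v -> filt n (En k v).
Proof.
elim=> {n v} [n|n|n x y _ IHx _ IHy|n c x _ IH|n g x fx IH].
- by rewrite linear0; apply: filt0.
- by rewrite En1; apply: filt0.
- by rewrite lin_D; apply: filtD.
- by rewrite lin_Z; apply: filtZ.
- rewrite EnF; apply/filtD; first exact/filtZ/filt_gen.
  case: (k == g); last exact: filt0.
  apply: (@filt_le _ _ n) => //; rewrite /Hn; apply/filtZ/filtB; exact: filt_Kn.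
Qed.

(** * Leading terms and the injectivity of [phi] *)

Section Injectivity.
Variable eps : int.
Local Notation El := (palg (relEl eps)).
Local Notation Xn i := (@pgen int (relEl eps) i).

Definition jop (i : int) : {linear N -> N} := act rhoN (j_gen eps i).

Lemma relEl_jop s t v : relEl eps s t -> act jop s v = act jop t v.
Proof. exact: (electrical_rel relU_rhoN). Qed.

Definition phi : {linear El -> N} := locked (plift pone relEl_jop).

Lemma phi1 : phi pone = pone.
Proof. by rewrite /phi -lock plift1. Qed.

Lemma phi_gen i b : phi (Xn i b) = Fn i (phi b)
  + q ^ (eps - 1) *: En (i - 1) (Kn (wopp (alpha (i - 1))) (phi b)).
Proof. by rewrite /phi -lock plift_gen. Qed.

Lemma phi_act s : act jop s pone = phi (pcls (relEl eps) s).
Proof. by rewrite /phi -lock /= plift_cls. Qed.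

Lemma filt_phi n b : filt n b -> filt n (phi b).
Proof.
elim=> {n b} [n|n|n x y _ IHx _ IHy|n c x _ IH|n g x fx IH].
- by rewrite linear0; apply: filt0.
- by rewrite phi1; apply: filt1.
- by rewrite lin_D; apply: filtD.
- by rewrite lin_Z; apply: filtZ.
- rewrite phi_gen; apply: filtD; first exact: filt_gen.
  apply/filtZ; apply: (@filt_le _ _ n) => //; exact/filt_En/filt_Kn.
Qed.

Definition shift_fun (i : int) (u : nat -> El) : nat -> El :=
  fun k => if k is k'.+1 then Xn i (u k') else 0.

Lemma shift_is_linear i : linear (shift_fun i).
Proof.
move=> c u w; apply/funext => -[|k] /=.
  by rewrite -[RHS]/(c *: 0 + 0) scaler0 addr0.
exact: linearP.
Qed.
HB.instance Definition _ i :=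
  GRing.isLinear.Build Kf (nat -> El) (nat -> El) _ (shift_fun i) (shift_is_linear i).
Definition shift i : {linear (nat -> El) -> (nat -> El)} := shift_fun i.

(** The quotient of [sgood] by [snull] is the product of the graded pieces of [El], so the
    associated graded space is handled through representatives. *)
Definition sgood (u : nat -> El) := forall k, filt k.+1 (u k).
Definition snull (u : nat -> El) := forall k, filt k (u k).
Definition sone : nat -> El := fun k => if k is 0 then pone else 0.

Lemma pgen_rel s t (b : El) : relEl eps s t -> act pgen s b = act pgen t b.
Proof. by move=> st; apply/act_pgen_sound/pe_rel. Qed.

(** A cubic expression raises degrees by three, so components 0, 1 and 2 vanish. In component
    [k + 3] the linear right-hand side lies in [filt k.+2], hence is null. *)
Lemma shift_serre c1 c3 c i j u : sgood u ->
  (forall b, serre_op c1 q2 c3 (Xn i) (Xn j) b = c *: Xn i b) ->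
  snull (serre_op c1 q2 c3 (shift i) (shift j) u - 0 *: u).
Proof.
move=> gu S0 k.
have low n x1 x2 x3 : x1 = 0 -> x2 = 0 -> x3 = 0 ->
    filt n (c1 *: x1 + - q2 *: x2 + c3 *: x3 - 0 *: u n : El).
  by move=> -> -> ->; rewrite !scaler0 scale0r !addr0 subr0; apply: filt0.
case: k => [|[|[|k]]]; try by apply: low; rewrite /= ?linear0.
change (filt k.+3 (serre_op c1 q2 c3 (Xn i) (Xn j) (u k) - 0 *: u k.+3)).
by rewrite S0 scale0r subr0; apply/filtZ/filt_gen/(filt_le _ (gu k)).
Qed.

Lemma shift_rel s t u : relN s t -> sgood u -> snull (act shift s u - act shift t u).
Proof.
case=> [i j ij|i|i] gu.
- move=> k; have low n x1 x2 : x1 = 0 -> x2 = 0 -> filt n (x1 - q ^ Defs.bij i j *: x2 : El).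
    by move=> -> ->; rewrite scaler0 subr0; apply: filt0.
  case: k => [|[|k]]; try by apply: low; rewrite /= ?linear0.
  change (filt k.+2 (Xn i (Xn j (u k)) - q ^ Defs.bij i j *: Xn j (Xn i (u k)))).
  by rewrite [Xn i _](pgen_rel _ (rEl_comm eps ij)) subrr; apply: filt0.
- by apply: shift_serre gu _ => b; apply: (pgen_rel _ (rEl_S1 eps i)).
- by apply: shift_serre gu _ => b; apply: (pgen_rel _ (rEl_S2 eps i)).
Qed.

Lemma shift_sound s t : peqv relN s t -> snull (act shift s sone - act shift t sone).
Proof.
move=> st; apply: (@act_sound_mod _ _ shift relN sgood snull) st _.
- by move=> k; apply: filt0.
- by move=> u v nu nv k; apply: filtD.
- by move=> c v nv k; apply: filtZ.
- by move=> g v nv [|k]; [apply: filt0 | apply/filt_gen/nv].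
- by move=> u v nu nv k; apply: filtD.
- by move=> c v nv k; apply: filtZ.
- by move=> g v nv [|k]; [apply: filt0 | apply/filt_gen/nv].
- exact: shift_rel.
- by case=> [|k]; [apply: filt1 | apply: filt0].
Qed.

(* The component of degree [k] of a representative of [m]; it is well defined
   modulo [filt k]. *)
Definition comp_deg (m : N) (k : nat) : El := act shift (prep m) sone k.

Lemma comp_deg_cls t k : filt k (comp_deg (pcls relN t) k - act shift t sone k).
Proof. exact: (shift_sound (prep_eqv relN t) k). Qed.

(** The chosen representative of a sum is unrelated to those of the summands, whence the error term
    in [filt k]. *)
Lemma comp_degD x y k : filt k (comp_deg (x + y) k - (comp_deg x k + comp_deg y k)).
Proof.
rewrite -{1}(prepK x) -{1}(prepK y) -pclsD.
exact: (comp_deg_cls (tAdd (prep x) (prep y)) k).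
Qed.

Lemma comp_degZ c x k : filt k (comp_deg (c *: x) k - c *: comp_deg x k).
Proof.
rewrite -{1}(prepK x) -pclsZ.
exact: (comp_deg_cls (tScale c (prep x)) k).
Qed.

Lemma comp_deg_gen i x k :
  filt k (comp_deg (Fn i x) k - shift_fun i (comp_deg x) k).
Proof.
rewrite -{1}(prepK x); have -> : Fn i (pcls relN (prep x)) = pcls relN (tMul (tG i) (prep x)).
  by rewrite -act_pgen.
exact: (comp_deg_cls (tMul (tG i) (prep x)) k).
Qed.

Lemma comp_deg1 k : filt k (comp_deg pone k - sone k).
Proof.
have := comp_deg_cls t1 k; congr (filt _ (_ - _)).
by rewrite /= scale1r.
Qed.

Lemma filt_congr n (x y : El) : filt n (x - y) -> filt n y -> filt n x.
Proof. by move=> fxy fy; rewrite -(subrK y x); apply: filtD. Qed.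

(** A generator moves components up by one degree, so a product of fewer than [n] generators
    contributes nothing from degree [n] on. *)
Lemma comp_deg_low n (m : N) k : filt n m -> (n <= k)%N -> filt k (comp_deg m k).
Proof.
move=> fm; elim: fm k => {n m} [n|n|n x y _ IHx _ IHy|n c x _ IH|n g x fx IH] k le_nk.
- apply: (filt_congr (y := 0 *: comp_deg 0 k)); last by rewrite scale0r; apply: filt0.
  by rewrite -{1}[0 : N](scale0r 0); apply: comp_degZ.
- apply: filt_congr (comp_deg1 k) _.
  by case: k le_nk => // k _; apply: filt0.
- by apply: filt_congr (comp_degD x y k) _; apply: filtD; auto.
- by apply: filt_congr (comp_degZ c x k) _; apply: filtZ; auto.
- apply: filt_congr (comp_deg_gen g x k) _.
  by case: k le_nk => // k le_nk; apply/filt_gen/IH.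
Qed.

(** The leading term of [b] is recovered from [phi b], by induction along the filtration. *)
Lemma comp_deg_phi n b : filt n.+1 b -> filt n (b - comp_deg (phi b) n).
Proof.
move=> fb; have: n.+1 = n.+1 by []; move: fb; move: {1 2}n.+1 => m fb.
elim: fb n => {m b} [m|m|m x y _ IHx _ IHy|m c x _ IH|m g x fx IH] n mn.
- rewrite linear0 sub0r; apply/filtN/(@comp_deg_low 0) => //; exact: filt0.
- have f1 := comp_deg1 n; have f2 : filt n (pone - sone n).
    by case: n mn {f1} => [|n] _; rewrite ?subrr ?subr0; [apply: filt0 | apply: filt1].
  have -> : pone - comp_deg (phi pone) n = (pone - sone n) - (comp_deg pone n - sone n).
    by rewrite phi1 opprB addrA subrK.
  exact: filtB.
- rewrite lin_D; have := comp_degD (phi x) (phi y) n.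
  have := filtD (IHx n mn) (IHy n mn); set a := comp_deg (phi x) n.
  set b := comp_deg (phi y) n; set s := comp_deg _ n => f1 f2.
  have -> : x + y - s = (x - a + (y - b)) - (s - (a + b)).
    by rewrite addrACA -opprD opprB addrA subrK.
  exact: filtB.
- rewrite lin_Z; have := comp_degZ c (phi x) n.
  have := filtZ c (IH n mn); set a := comp_deg (phi x) n.
  set s := comp_deg _ n => f1 f2.
  have -> : c *: x - s = c *: (x - a) - (s - c *: a).
    by rewrite scalerBr opprB addrA subrK.
  exact: filtB.
- case: mn => mn; subst m; rewrite phi_gen.
  (* The summand coming from [E_{g-1}] has lower degree, so it does not affect component [n]. *)
  set y := q ^ _ *: _; have fy : filt n y.
    by apply/filtZ/filt_En/filt_Kn/filt_phi.
  have f1 := comp_deg_low fy (leqnn n).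
  have f2 := comp_degD (Fn g (phi x)) y n.
  have f3 := comp_deg_gen g (phi x) n.
  have f4 : filt n (Xn g x - shift_fun g (comp_deg (phi x)) n).
    (* In degree 0 the shift is zero, and so is [x], which lies in [filt 0]. *)
    case: n {f1 f2 f3 fy} fx IH => [|n] fx IH /=.
      by rewrite (filt_bottom fx) linear0 subr0; apply: filt0.
    by rewrite -linearB; apply/filt_gen/IH.
  move: f1 f2 f3 f4; set a := comp_deg y n; set b := shift_fun _ _ _.
  set d := comp_deg (Fn g _) n; set s := comp_deg _ n => f1 f2 f3 f4.
  have -> : Xn g x - s = (Xn g x - b) - ((s - (d + a)) + ((d - b) + a)).
    by move: (Xn g x) => e; linear_combination Kf; ring.
  by apply: filtB => //; apply: filtD => //; apply: filtD.
Qed.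

(** If [phi b] vanishes, [comp_deg_phi] pushes [b] from [filt n.+1] into [filt n]; descending
    reaches [filt 0]. *)
Lemma phi_inj b : phi b = 0 -> b = 0.
Proof.
move=> phib; have [n] := filt_exhaustive b.
elim: n => [|n IH fb]; first exact: filt_bottom.
apply: IH; apply: filt_congr (comp_deg_phi fb) _; rewrite phib.
exact: comp_deg_low (filt0 _ 0) _.
Qed.

Lemma jmap_injective s t : U_eqv (jmap eps s) (jmap eps t) -> El_eqv eps s t.
Proof.
move=> st; apply/pcls_eq/subr0_eq/phi_inj; apply/eqP; rewrite linearB subr_eq0; apply/eqP.
rewrite -!phi_act -!(act_tmap rhoN (j_gen eps)).
exact: (act_sound relU_rhoN).
Qed.
End Injectivity.

Lemma jmap_sound eps s t : El_eqv eps s t -> U_eqv (jmap eps s) (jmap eps t).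
Proof.
move=> st; apply/pcls_eq; rewrite -!act_pone !act_tmap.
apply: act_sound st; apply: electrical_rel => s' t' v st'.
exact/act_pgen_sound/pe_rel.
Qed.

(** * Comultiplication *)

Local Notation W := (palg relUU).

Definition opL (g : Ugen) : {linear W -> W} := pgen (inl g).
Definition opR (g : Ugen) : {linear W -> W} := pgen (inr g).

Lemma act_embL s (v : W) : act pgen (embL s) v = act opL s v.
Proof. exact: act_tmap. Qed.
Lemma act_embR s (v : W) : act pgen (embR s) v = act opR s v.
Proof. exact: act_tmap. Qed.

Lemma relU_opL s t v : Defs.relU s t -> act opL s v = act opL t v.
Proof. by move=> st; rewrite -!act_embL; apply/act_pgen_sound/pe_rel/rUU_L. Qed.
Lemma relU_opR s t v : Defs.relU s t -> act opR s v = act opR t v.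
Proof. by move=> st; rewrite -!act_embR; apply/act_pgen_sound/pe_rel/rUU_R. Qed.

(** The presentation makes only generators of the two copies commute; induction on both terms
    extends this. *)
Lemma opLR_comm s t v : act opL s (act opR t v) = act opR t (act opL s v).
Proof.
have gen_comm g u : act opL (tG g) (act opR t u) = act opR t (act opL (tG g) u).
  elim: t u => {v} [c|k|a IHa b IHb|a IHa b IHb] v /=.
  - by rewrite linearZ.
  - exact: (act_pgen_sound v (pe_rel (rUU_comm g k))).
  - by rewrite raddfD /=; congr (_ + _); [apply: IHa | apply: IHb].
  - by rewrite -IHb -IHa.
elim: s v => [c|g|a IHa b IHb|a IHa b IHb] v /=.
- by rewrite linearZ.
- exact: gen_comm.
- by rewrite raddfD /= IHa IHb.
- by rewrite IHb IHa.
Qed.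

Lemma act_tens s t (v : W) : act pgen (tens s t) v = act opL s (act opR t v).
Proof. by rewrite /= act_embL act_embR. Qed.

Lemma act_tsum (S : Type) (f : S -> term UUgen) (ps : seq S) (v : W) :
  act pgen (tsum [seq f p | p <- ps]) v = \sum_(p <- ps) act pgen (f p) v.
Proof.
elim: ps => [|p ps IH] /=; first by rewrite big_nil scale0r.
by rewrite big_cons -IH.
Qed.

(** In the first part of the coproduct of [E_{i-1} K_{-alpha_{i-1}}] the weights cancel in the left
    factor. In the second part the right factor has weight [- gamma (i - 1)], which is [beta i]. *)
Lemma Delta_j_gen eps i (v : W) : act pgen (Delta (j_gen eps i)) v =
  act opR (j_gen eps i) v + act opL (j_gen eps i) (opR (UK (beta i)) v).
Proof.
set a := alpha (i - 1); set c := q ^ (eps - 1).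
have KK : opL (UK a) (opL (UK (wopp a)) v) = v by apply: (Ko_opp relU_opL).
have swap g k u : opR g (opL k u) = opL k (opR g u).
  exact/esym/(opLR_comm (tG k) (tG g)).
have -> : act pgen (Delta (j_gen eps i)) v =
    opL (UF i) (opR (UK (beta i)) v) + 1 *: opR (UF i) v
    + c *: (opL (UK a) (opR (UE (i - 1)) (opL (UK (wopp a)) (opR (UK (wopp a)) v)))
            + opL (UE (i - 1)) (opR (UK (wadd a (wopp (gamma (i - 1)))))
                (opL (UK (wopp a)) (opR (UK (wopp a)) v)))).
  by [].
rewrite !swap (Ko_opp relU_opL) (Ko_add relU_opR) scale1r.
have -> : opR (UK (wadd (wadd a (wopp (gamma (i - 1)))) (wopp a))) v = opR (UK (beta i)) v.
  apply: (Ko_ext relU_opR) => k; rewrite /wadd /wopp /gamma /wopp subrK opprK.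
  by rewrite addrC addKr.
by rewrite scalerDr addrACA [opL _ _ + _]addrC addrACA [X in X + _]addrC addrC.
Qed.

(** Expansions of this shape form a subalgebra containing the coproducts of the generators of [C].
    As an identity of operators it can be multiplied out by linearity. *)
Lemma Delta_jmap_expand eps s : exists ps : seq (term int * term Ugen),
  forall v : W, act pgen (Delta (jmap eps s)) v =
    \sum_(p <- ps) act opL (jmap eps p.1) (act opR p.2 v).
Proof.
elim: s => [c|i|a [pa IHa] b [pb IHb]|a [pa IHa] b [pb IHb]].
- by exists [:: (tC c, t1)] => v; rewrite big_seq1 /= scale1r.
- exists [:: (t1, j_gen eps i); (tG i, tG (UK (beta i)))] => v.
  by rewrite big_cons big_seq1 [LHS]Delta_j_gen /= scale1r.
- by exists (pa ++ pb) => v; rewrite big_cat -IHa -IHb.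
(* The two tensor factors commute, so pure tensors multiply componentwise. *)
- exists [seq (tMul p.1 p'.1, tMul p.2 p'.2) | p <- pa, p' <- pb] => v.
  rewrite [LHS]/= IHb IHa big_allpairs_dep /=; apply: eq_bigr => p _.
  rewrite !linear_sum /=; apply: eq_bigr => p' _.
  by rewrite -opLR_comm.
Qed.

Theorem mainTheorem9 (eps : int) (heps : eps = 1 \/ eps = -1) :
  [/\ (* j is a well-defined algebra homomorphism El_eps -> U *)
      (forall s t : term int, El_eqv eps s t -> U_eqv (jmap eps s) (jmap eps t)),
      (* j is injective *)
      (forall s t : term int, U_eqv (jmap eps s) (jmap eps t) -> El_eqv eps s t),
      (* right coideal: Delta(C) is contained in C (x) U *)
      (forall s : term int, exists ps : seq (term int * term Ugen),
          UU_eqv (Delta (jmap eps s))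
                 (tsum [seq tens (jmap eps p.1) p.2 | p <- ps]))
    & (* explicit formula on generators *)
      (forall i : int,
          UU_eqv (Delta (jmap eps (tG i)))
                 (tAdd (tens t1 (jmap eps (tG i)))
                       (tens (jmap eps (tG i)) (tG (UK (beta i))))))].
Proof.
split.
- exact: jmap_sound.
- exact: jmap_injective.
- move=> s; have [ps psE] := Delta_jmap_expand eps s; exists ps.
  (* Equality in the tensor square is tested on its unit vector. *)
  apply/pcls_eq; rewrite -!act_pone psE act_tsum.
  by apply: eq_bigr => p _; rewrite act_tens.
- move=> i; apply/pcls_eq; rewrite -!act_pone.
  rewrite [LHS]Delta_j_gen -[RHS]/(act pgen (tens t1 (j_gen eps i)) pone
    + act pgen (tens (j_gen eps i) (tG (UK (beta i)))) pone).
  by rewrite !act_tens /= scale1r.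
Qed.
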